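(* Let $A\in\mathbb R^{(d+1)\times(d+1)}$ be the matrix with entries $[A]_{ji}=\int_{F_j}\lambda_i\,\omega_j\,d\boldsymbol x$. If $A$ is invertible, then there exist choices of (1) functions $q_j\in\mathbb S_2(F_j)$, $j=0,\dots,d$; (2) an interior space $\mathbb V$ with a basis $\{\rho_k\}_{k=1}^{\tilde d}$ orthonormal with respect to $\langle\cdot,\cdot\rangle_\Omega$; (3) a face space $\mathbb W$ with basis $\{\psi_j\}_{j=0}^d$, with $\mathbb S_2(S_d)=\mathbb V\oplus\mathbb W$, such that: (i) the set $\Sigma=\{\mathcal I_j,\mathcal L_j,\mathcal V_k: j=0,\dots,d,\ k=1,\dots,\tilde d\}$ is unisolvent on $\mathbb P_2(S_d)$; (ii) $\mathbb V$ and $\mathbb W$ are orthogonal with respect to $\langle\cdot,\cdot\rangle_\Omega$, and therefore the blocks $G=[\langle\rho_\ell,\rho_k\rangle_\Omega]_{k\ell}$ and $C=[\langle\psi_i,\rho_k\rangle_\Omega]_{ki}$ satisfy $G=I_{\tilde d}$ and $C=0$.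
   Context: Let $d\ge 2$ and let $S_d\subset\mathbb R^d$ be a nondegenerate $d$-simplex with vertices $\boldsymbol v_0,\dots,\boldsymbol v_d$ and barycentric coordinates $\lambda_0,\dots,\lambda_d$. $F_j$ is the face opposite $\boldsymbol v_j$. $\mathbb P_k(X)$ is the space of (restrictions to $X$ of) polynomials of total degree at most $k$. $\Omega\in L^1(S_d)$ is a probability density, strictly positive a.e. in the interior of $S_d$. For each $j$, the induced face density $\omega_j$ is the normalized conditional trace of $\Omega$ on $F_j$: for every $\phi$ continuous on $F_j$ (extended continuously to $S_d$), $$\int_{F_j}\phi\,\omega_j\,d\boldsymbol x=\lim_{\varepsilon\to0^+}\frac{\int_{\{\lambda_j<\varepsilon\}}\phi\,\Omega\,d\boldsymbol\sigma}{\int_{\{\lambda_j<\varepsilon\}}\Omega\,d\boldsymbol\sigma};$$ it is assumed that this limit exists and defines a probability density $\omega_j\in L^1(F_j)$, positive a.e. on $F_j$ (with respect to $(d-1)$-dimensional Lebesgue measure). Set $\langle f,g\rangle_\Omega=\int_{S_d}fg\,\Omega\,d\boldsymbol\sigma$ and $\langle f,g\rangle_{\omega_j}=\int_{F_j}fg\,\omega_j\,d\boldsymbol x$ (functions on $S_d$ are restricted to $F_j$). $\mathbb S_2(S_d)=\{p\in\mathbb P_2(S_d):\langle p,\varphi\rangle_\Omega=0\ \forall\varphi\in\mathbb P_1(S_d)\}$, of dimension $d(d+1)/2$; similarly $\mathbb S_2(F_j)=\{q\in\mathbb P_2(F_j):\langle q,\varphi\rangle_{\omega_j}=0\ \forall\varphi\in\mathbb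 P_1(F_j)\}$. Let $\tilde d=(d-2)(d+1)/2$ (so $\tilde d=0$, $\mathbb V=\{0\}$ if $d=2$). Given $q_j$ and $\rho_k\in\mathbb S_2(S_d)$, the functionals are $\mathcal I_j(f)=\langle f,1\rangle_{\omega_j}$, $\mathcal L_j(f)=\langle f,q_j\rangle_{\omega_j}$, $\mathcal V_k(f)=\langle f,\rho_k\rangle_\Omega$. ''$\Sigma$ is unisolvent on $\mathbb P_2(S_d)$'' means that the only $p\in\mathbb P_2(S_d)$ annihilated by all functionals in $\Sigma$ is $p=0$ (the number of functionals equals $\dim\mathbb P_2(S_d)$). *)

(* Defs.v *)
From HB Require Import structures.
From mathcomp Require Import all_boot all_order all_algebra.
From mathcomp Require Import -(notations) mpoly.
From mathcomp Require Import all_classical all_reals all_analysis.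
From mathcomp Require Import measurable_realfun.

Set Implicit Arguments.
Unset Strict Implicit.
Unset Printing Implicit Defensive.
Import Order.TTheory GRing.Theory Num.Theory.
Import numFieldNormedType.Exports.

Local Open Scope classical_set_scope.
Local Open Scope ring_scope.

Definition rV_display : measure_display. Proof. exact: default_measure_display. Qed.

Section measurable_rV.
Context {R : realType} {n : nat}.

Let coord (i : 'I_n) (x : 'rV[R]_n) : measurableTypeR R := x ord0 i.

Let rV_set0 : g_sigma_preimage coord set0.
Proof. exact: sigma_algebra0. Qed.

Let rV_setC A : g_sigma_preimage coord A -> g_sigma_preimage coord (~` A).
Proof. exact: sigma_algebraC. Qed.

Let rV_bigcup (F : _^nat) : (forall i, g_sigma_preimage coord (F i)) ->
  g_sigma_preimage coord (\bigcup_i (F i)).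
Proof. exact: sigma_algebra_bigcup. Qed.

(* The product sigma-algebra, i.e. the Borel sets of R^n. *)
HB.instance Definition _ := @isMeasurable.Build rV_display
  'rV[R]_n (g_sigma_preimage coord) rV_set0 rV_setC rV_bigcup.

End measurable_rV.

Lemma measurable_coord (R : realType) n (i : 'I_n) :
  measurable_fun [set: 'rV[R]_n] (fun x => x ord0 i : measurableTypeR R).
Proof.
move=> _ Y mY; rewrite setTI; apply: sub_sigma_algebra => /=.
rewrite -bigcup_seq/=; exists i => /=; first by rewrite mem_index_enum.
by exists Y => //; rewrite setTI.
Qed.

Lemma measurable_fun_rV d (T : measurableType d) (R : realType) n
    (f : T -> 'rV[R]_n) :
  (forall i, measurable_fun [set: T]
     (fun t => f t ord0 i : measurableTypeR R)) ->
  measurable_fun [set: T] f.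
Proof.
move=> mf _ Y mY; rewrite setTI.
have : (image_set_system setT f measurable) Y.
  move: mY; rewrite /measurable/=; apply; split.
    apply: sigma_algebra_image; exact: sigma_algebra_measurable.
  move=> A; rewrite -bigcup_seq => -[i _ [B mB <-]].
  have := mf i measurableT B mB.
  by rewrite /image_set_system/= !setTI.
by rewrite /image_set_system/= setTI.
Qed.

Definition image_measure d d' (T : measurableType d) (T' : measurableType d')
    (R : realType) (m : {measure set T -> \bar R}) (f : T -> T')
    (mf : measurable_fun [set: T] f) : {measure set T' -> \bar R} :=
  measure_function_pushforward__canonical__measure_function_Measure m mf.

Section lebesgue_rV.
Context {R : realType}.

Definition rV_rcons n (z : 'rV[R]_n * measurableTypeR R) : 'rV[R]_n.+1 :=
  \row_(i < n.+1) oapp (z.1 ord0) z.2 (unlift ord_max i).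

Lemma measurable_rV_rcons n : measurable_fun setT (@rV_rcons n).
Proof.
apply: measurable_fun_rV => i; case: (unliftP ord_max i) => [k|] ->.
  under eq_fun do rewrite mxE liftK.
  exact: (measurableT_comp (measurable_coord k) measurable_fst).
under eq_fun do rewrite mxE unlift_none.
exact: measurable_snd.
Qed.

(* The n-fold product of the Lebesgue measure of R, carried to row vectors. *)
Fixpoint lebesgue_rV n : {measure set 'rV[R]_n -> \bar R} :=
  match n with
  | 0 => [the measure _ _ of \d_ (0 : 'rV[R]_0)]
  | m.+1 => image_measure [the measure _ _ of
      (lebesgue_rV m \x (@lebesgue_measure R))%E] (@measurable_rV_rcons m)
  end.

End lebesgue_rV.

Section surface_measure.
Context {R : realType} {d n : nat}.
Variable w : 'I_n.+1 -> 'rV[R]_d.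

Definition edge_mx : 'M[R]_(n, d) :=
  \matrix_(i < n) (w (lift ord0 i) - w ord0).

Definition affine_param (u : 'rV[R]_n) : 'rV[R]_d := w ord0 + u *m edge_mx.

Lemma measurable_affine_param : measurable_fun setT affine_param.
Proof.
apply: measurable_fun_rV => i.
under eq_fun do rewrite mxE mxE.
apply: measurable_funD => //; apply: measurable_sum => k.
by apply: measurable_funM => //; exact: measurable_coord.
Qed.

(* n-dimensional Lebesgue measure on the affine hull of the points w i: image
   under affine_param of the Lebesgue measure of R^n, times the constant volume
   element sqrt (det (E E^T)). *)
Definition surface_measure : {measure set 'rV[R]_d -> \bar R} :=
  [the measure _ _ of
    mscale (NngNum (Num.Theory.sqrtr_ge0 (\det (edge_mx *m edge_mx^T))))
           (image_measure (lebesgue_rV n) measurable_affine_param)].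

End surface_measure.

Section simplex.
Context {R : realType} {d : nat}.

Definition conv_hull n (w : 'I_n -> 'rV[R]_d) : set 'rV[R]_d :=
  [set x | exists c : 'I_n -> R,
     [/\ forall i, 0 <= c i, \sum_i c i = 1 & x = \sum_i c i *: w i]].

Variable v : 'I_d.+1 -> 'rV[R]_d.

Definition nondegenerate_simplex : Prop := row_free (edge_mx v).

Definition simplex : set 'rV[R]_d := conv_hull v.

(* For a nondegenerate simplex, c_i := bary i x is the unique solution of
   \sum_i c_i = 1, \sum_i c_i v_i = x: the matrix has rows (1, v_k). *)
Definition bary (i : 'I_d.+1) (x : 'rV[R]_d) : R :=
  ((row_mx 1%:M x : 'rV[R]_(1 + d)) *m
     invmx (\matrix_(k < 1 + d) row_mx 1%:M (v k))) ord0 i.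

(* The vertices other than v j, in order; for d > 0 this is v \o lift j, up to
   the cast between 'I_d and 'I_d.-1.+1. *)
Definition face_vertex (j : 'I_d.+1) (i : 'I_d.-1.+1) : 'rV[R]_d :=
  v (inord (bump j i)).

Definition face (j : 'I_d.+1) : set 'rV[R]_d := conv_hull (face_vertex j).

Definition face_measure (j : 'I_d.+1) : {measure set 'rV[R]_d -> \bar R} :=
  surface_measure (face_vertex j).

End simplex.

Section densities.
Context {R : realType} {d : nat}.
Local Notation E := ('rV[R]_d -> R).

Definition prob_density (mu : {measure set 'rV[R]_d -> \bar R})
    (X : set 'rV[R]_d) (w : E) : Prop :=
  [/\ mu.-integrable X (EFin \o w),
      {ae mu, forall x, X x -> 0 <= w x} &
      \int[mu]_(x in X) w x = 1].

(* By Tietze, testing against phi continuous on the simplex is testing against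
   all continuous phi on the face together with all their extensions. *)
Definition conditional_trace (v : 'I_d.+1 -> 'rV[R]_d) (Omega : E)
    (j : 'I_d.+1) (omega : E) : Prop :=
  forall phi : E, {within simplex v, continuous phi} ->
    let slab eps := [set x | simplex v x /\ bary v j x < eps] in
    (\int[lebesgue_rV d]_(x in slab eps) (phi x * Omega x) /
     \int[lebesgue_rV d]_(x in slab eps) Omega x) @[eps --> 0^'+]
    --> \int[face_measure v j]_(x in face v j) (phi x * omega x).

Definition weighted_inner (mu : {measure set 'rV[R]_d -> \bar R})
    (X : set 'rV[R]_d) (w f g : E) : R :=
  \int[mu]_(x in X) (f x * g x * w x).

End densities.

Section polynomial_spaces.
Context {R : realType} {d : nat}.
Local Notation E := ('rV[R]_d -> R).

(* A function on X is represented by its extension by 0 outside X, so that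
   equality in E is equality on X. *)
Definition poly_space (k : nat) (X : set 'rV[R]_d) : set E :=
  [set f | exists2 p : mpoly d R, (msize p <= k.+1)%N &
     f = patch (cst 0) X (fun x => meval (x ord0) p)].

Definition S2_space (X : set 'rV[R]_d) (ip : E -> E -> R) : set E :=
  [set p | poly_space 2 X p /\
     forall phi, poly_space 1 X phi -> ip p phi = 0].

Definition is_basis (V : set E) n (b : 'I_n -> E) : Prop :=
  V = [set f | exists c : 'I_n -> R, f = \sum_i c i *: b i] /\
  forall c : 'I_n -> R, \sum_i c i *: b i = 0 -> forall i, c i = 0.

Definition direct_sum (U V W : set E) : Prop :=
  U = [set f + g | f in V & g in W] /\ V `&` W = [set 0].

Definition unisolvent (X : set E) (Sigma : set (E -> R)) : Prop :=
  forall p, X p -> (forall L, Sigma L -> L p = 0) -> p = 0.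

End polynomial_spaces.

(* Main.v *)
(* Let [e j] be d + 1 distinct edges, [e j] not containing the vertex [j], e.g.
   {j+1, j+2} modulo d + 1. A polynomial of degree at most 2 is uniquely a
   combination of the barycentric coordinates [lambda_a] and of the products
   [lambda_a lambda_b], a < b. Duality on each face gives [q_j] in S_2(F_j) for
   which [L_j p] is the coefficient of the monomial of [e j] in [p]. The [L_j]
   vanish on affine functions and are linearly independent, so their Riesz
   representers [psi_j] in P_2(S_d) lie in S_2(S_d) and are independent. Let W
   be their span and V its orthogonal complement in S_2(S_d). If p = p_1 + s
   with p_1 affine and s in S_2(S_d), the V_k and L_j kill s, and then the I_j kill
   p_1 because A is invertible. Only the definiteness of the weighted inner
   products needs measure theory. *)
Require Import Defs.
From mathcomp Require Import all_boot all_order all_algebra.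
From mathcomp Require Import -(notations) mpoly.
From mathcomp Require Import all_classical all_reals all_analysis.
From mathcomp Require Import measurable_realfun.
From mathcomp Require Import zify lra ring.

Set Implicit Arguments.
Unset Strict Implicit.
Unset Printing Implicit Defensive.
Import Order.TTheory GRing.Theory Num.Theory.
Import numFieldNormedType.Exports.
Local Open Scope classical_set_scope.
Local Open Scope ring_scope.

(** * Positive definite matrices: orthonormalization and orthogonal complements *)

Section Gram.
Variable R : rcfType.

Definition posdefmx n (G : 'M[R]_n) :=
  G^T = G /\ forall u : 'rV_n, u != 0 -> 0 < (u *m G *m u^T) 0 0.

Lemma posdefmx_unit n (G : 'M[R]_n) : posdefmx G -> G \in unitmx.
Proof.
move=> [_ Gp]; rewrite -row_free_unit; apply: inj_row_free => u uG.
by apply/eqP/negP => /negP /Gp; rewrite uG mul0mx mxE ltxx.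
Qed.

Lemma posdefmx_congr m n (B : 'M[R]_(m, n)) (G : 'M[R]_n) :
  row_free B -> posdefmx G -> posdefmx (B *m G *m B^T).
Proof.
move=> Bf [Gs Gp]; split; first by rewrite !trmx_mul trmxK Gs mulmxA.
move=> u u0; have := Gp (u *m B); rewrite trmx_mul !mulmxA; apply.
by rewrite mulmx_free_eq0.
Qed.

(** Gram-Schmidt by blocks. The rows of [Z] are [G]-orthogonal to the first unit vector, and the
    form they carry (the Schur complement) is again positive definite, so the induction
    orthonormalizes them; scaling the first unit vector by [r] supplies the missing row. *)
Lemma posdefmx_orthonormalize n (G : 'M[R]_n) : posdefmx G ->
  exists P : 'M[R]_n, P \in unitmx /\ P *m G *m P^T = 1%:M.
Proof.
elim: n => [|n IHn] in G *.
  by move=> _; exists 1%:M; rewrite unitmx1; split => //; apply/matrixP => -[].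
rewrite -[n.+1]/(1 + n)%N in G * => Gp.
pose g := ulsubmx G 0 0; pose b := ursubmx G; pose H := drsubmx G.
have GE : G = block_mx g%:M b b^T H.
  rewrite -[LHS]submxK; congr block_mx; first exact: mx11_scalar.
  by rewrite /b trmx_ursub Gp.1.
have g0 : 0 < g.
  have e0 : row_mx 1%:M (0 : 'rV[R]_n) != 0.
    apply/eqP => /rowP /(_ 0) /eqP.
    by rewrite mxE split1 unlift_none /= !mxE oner_eq0.
  have := Gp.2 _ e0; rewrite GE mul_row_block tr_row_mx mul_row_col.
  by rewrite !mul1mx !mul0mx trmx0 !mulmx0 !addr0 trmx1 mulmx1 mxE mulr1n.
pose Z : 'M[R]_(n, 1 + n) := row_mx (- g^-1 *: b^T) 1%:M.
have Zf : row_free Z.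
  apply: inj_row_free => u; rewrite mul_mx_row mulmx1 => uZ.
  by have := congr1 rsubmx uZ; rewrite row_mxKr linear0.
have [Q [Qu QZ]] := IHn _ (posdefmx_congr Zf Gp).
have ZG : Z *m G = row_mx 0 (H - g^-1 *: (b^T *m b)).
  rewrite GE mul_row_block !mul1mx mul_mx_scalar scalerA mulrN divff ?gt_eqF //.
  by rewrite scaleN1r addNr -scalemxAl scaleNr addrC.
pose r := (Num.sqrt g)^-1.
have rg : r * g * r = 1.
  by rewrite /r mulrAC -expr2 exprVn sqr_sqrtr ?ltW // mulVf ?gt_eqF.
pose P : 'M[R]_(1 + n) := col_mx (row_mx r%:M 0) (Q *m Z).
have PG : P *m G *m P^T = 1%:M.
  have eZ : Q *m Z *m G *m (row_mx r%:M 0)^T = 0.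
    rewrite -(mulmxA Q) ZG -mulmxA tr_row_mx mul_row_col mul0mx trmx0 mulmx0.
    by rewrite addr0 mulmx0.
  have eZ' : row_mx r%:M 0 *m G *m (Q *m Z)^T = 0.
    by rewrite -[RHS]trmx0 -eZ !trmx_mul !trmxK Gp.1 !mulmxA.
  rewrite /P mul_col_mx tr_col_mx mul_col_row eZ eZ'.
  rewrite trmx_mul !mulmxA in QZ *; rewrite QZ.
  rewrite GE mul_row_block tr_row_mx mul_row_col !mul0mx trmx0 mulmx0 !addr0.
  by rewrite tr_scalar_mx -!scalar_mxM rg -scalar_mx_block.
by exists P; split => //; have [] := mulmx1_unit PG; rewrite unitmx_mul => /andP [].
Qed.

(** The linear algebra of the construction, in coordinates. [G] is the Gram matrix, the rows of
    [Lam] span the affine functions and those of [L] are functionals, with Riesz representers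
    [Psi = L G^-1]. The relation [L *m Lam^T = 0] makes [Psi] [G]-orthogonal to [Lam]; [Rho] is an
    orthonormal basis of what is orthogonal to both. *)
Lemma orthonormal_complement n p q m (G : 'M[R]_n) (Lam : 'M[R]_(p, n))
    (L : 'M[R]_(q, n)) :
  posdefmx G -> row_free Lam -> row_free L -> L *m Lam^T = 0 ->
  (m + p + q)%N = n ->
  exists (Rho : 'M[R]_(m, n)) (Psi : 'M[R]_(q, n)),
    [/\ Psi *m G = L, Rho *m G *m Rho^T = 1%:M, Rho *m G *m Lam^T = 0,
        Rho *m L^T = 0 &
        forall u : 'rV_n, exists a b c,
          u = a *m Lam + b *m Rho + c *m Psi].
Proof.
move=> Gp Lamf Lf LLam mpq.
have Gu := posdefmx_unit Gp.
have [Psi PsiG Psif] : exists2 Psi : 'M[R]_(q, n), Psi *m G = L & row_free Psi.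
  exists (L *m invmx G); first by rewrite mulmxKV.
  by rewrite /row_free mxrankMfree ?row_free_unit ?unitmx_inv.
have GPsi : G *m Psi^T = L^T by rewrite -PsiG trmx_mul Gp.1.
have PsiGPsi := posdefmx_unit (posdefmx_congr Psif Gp).
have LamGLam := posdefmx_unit (posdefmx_congr Lamf Gp).
pose K := kermx (row_mx (G *m Lam^T) L^T).
have LamL : Lam *m L^T = 0 by rewrite -[Lam]trmxK -trmx_mul LLam trmx0.
(* Dimension count: the rows of [Lam] and [Psi] are jointly independent, because pairing a relation
   with [Psi] kills its [Psi] part and [Lam] is free. Hence [K] is cut out by [p + q] independent
   equations. *)
have rkK : m = \rank K.
  have f : row_free (row_mx (G *m Lam^T) L^T)^T.
    rewrite tr_row_mx trmx_mul !trmxK Gp.1 -PsiG -mul_col_mx.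
    rewrite /row_free mxrankMfree ?row_free_unit //.
    apply: inj_row_free => u; rewrite -[u]hsubmxK mul_row_col => e.
    have : rsubmx u *m (Psi *m G *m Psi^T) = 0.
      have := congr1 (mulmx^~ (G *m Psi^T)) e.
      by rewrite mul0mx mulmxDl -!mulmxA GPsi LamL mulmx0 add0r.
    move=> /(congr1 (mulmx^~ (invmx (Psi *m G *m Psi^T)))).
    rewrite mulmxK // mul0mx => r0; move: e; rewrite r0 mul0mx addr0.
    by move=> /eqP; rewrite mulmx_free_eq0 // => /eqP ->; rewrite row_mx0.
  by move: f; rewrite mxrank_ker /row_free mxrank_tr => /eqP ->; lia.
have [B [Bf BK]] : exists B : 'M[R]_(m, n), row_free B /\ (B :=: K)%MS.
  rewrite {}rkK; exists (row_base K).
  by split; [exact: row_base_free|exact: eq_row_base].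
have [P [Pu PB]] := posdefmx_orthonormalize (posdefmx_congr Bf Gp).
have BLamL : B *m row_mx (G *m Lam^T) L^T = 0.
  by apply/sub_kermxP; rewrite BK.
move: BLamL; rewrite mul_mx_row -row_mx0 => /eq_row_mx [BLam BL].
exists (P *m B), Psi; split => //.
- by rewrite trmx_mul !mulmxA in PB *.
- by rewrite -!mulmxA BLam mulmx0.
- by rewrite -!mulmxA BL mulmx0.
move=> u.
have [a aE] : exists a, a *m (Lam *m G *m Lam^T) = u *m G *m Lam^T.
  by exists (u *m G *m Lam^T *m invmx (Lam *m G *m Lam^T)); rewrite mulmxKV.
have [c cE] : exists c, c *m (Psi *m G *m Psi^T) = u *m L^T.
  by exists (u *m L^T *m invmx (Psi *m G *m Psi^T)); rewrite mulmxKV.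
(* [a] and [c] are the coordinates of the [G]-orthogonal projections of [u] on [Lam] and [Psi], so
   the remainder satisfies both families of equations. *)
have : (u - a *m Lam - c *m Psi <= B)%MS.
  rewrite BK; apply/sub_kermxP; rewrite mul_mx_row !mulmxBl.
  have -> : c *m Psi *m (G *m Lam^T) = 0.
    by rewrite -!mulmxA (mulmxA Psi) PsiG LLam !mulmx0.
  have -> : a *m Lam *m L^T = 0 by rewrite -mulmxA LamL mulmx0.
  have -> : a *m Lam *m (G *m Lam^T) = u *m (G *m Lam^T).
    by rewrite -!mulmxA in aE *.
  have -> : c *m Psi *m L^T = u *m L^T.
    by rewrite -cE -!mulmxA GPsi.
  by rewrite !subr0 !subrr row_mx0.
move=> /submxP [b ub]; exists a, (b *m invmx P), c.
by rewrite (mulmxA (b *m _)) mulmxKV // -ub -[RHS]addrA addrNK addrC addrNK.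
Qed.
End Gram.

(** * Continuous functions that vanish almost everywhere on an open set *)

Section lebesgue_rV_null.
Context {R : realType}.

Lemma open_box n (U : set 'rV[R]_n) a : open U -> U a ->
  exists2 e : R, 0 < e &
    [set x : 'rV[R]_n | forall i, a 0 i - e < x 0 i < a 0 i + e] `<=` U.
Proof.
move=> oU Ua; have /nbhs_ballP [e e0 eU] := open_nbhs_nbhs (conj oU Ua).
exists e => // x /= xe; apply: eU; split=> // i j; rewrite ord1.
by rewrite /ball /= ltr_distlC; exact: xe.
Qed.

Lemma measurable_box n (a b : 'I_n -> R) :
  measurable [set x : 'rV[R]_n | forall i, a i < x 0 i < b i].
Proof.
rewrite (_ : [set _ | _] =
    \bigcap_(i : 'I_n) [set x : 'rV[R]_n | a i < x 0 i < b i]); last first.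
  by apply/seteqP; split => x /= h i; [move=> _; exact: h|exact: (h i)].
apply: fin_bigcap_measurable => // i _.
have := @measurable_coord R n i measurableT _ (measurable_itv `]a i, b i[%R).
rewrite setTI; congr (measurable _).
Qed.

Lemma lebesgue_rV_box_gt0 n (a b : 'I_n -> R) : (forall i, a i < b i) ->
  (0 < lebesgue_rV n [set x : 'rV[R]_n | forall i, a i < x 0 i < b i]%R)%E.
Proof.
elim: n => [|n IHn] in a b * => ab /=.
  by rewrite diracE mem_set ?lte01 // => -[].
rewrite /pushforward.
rewrite (_ : _ @^-1` _ =
  [set x : 'rV[R]_n | forall i, a (lift ord_max i) < x 0 i < b (lift ord_max i)]
  `*` `]a ord_max, b ord_max[%classic).
  rewrite product_measure1E //; last exact: measurable_box.
  apply: mule_gt0; first exact: IHn.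
  have := @lebesgue_measure_itv R `]a ord_max, b ord_max[%R.
  by rewrite /= lte_fin ab => ->; rewrite -EFinB lte_fin subr_gt0.
apply/seteqP; split => -[x y] /= h.
  split => [i|]; first by have := h (lift ord_max i); rewrite mxE liftK.
  by have := h ord_max; rewrite mxE unlift_none /= in_itv.
move=> i; case: h => h1; rewrite in_itv /= => h2.
by case: (unliftP ord_max i) => [k|] ->; rewrite mxE ?liftK ?unlift_none.
Qed.

(** Around a point of [U] with [g] nonzero there would be a whole box of such points, and a box of
    positive measure does not fit in a null set. *)
Lemma ae0_open_continuous n (g : 'rV[R]_n -> R) (U : set 'rV[R]_n) :
  continuous g -> open U ->
  {ae lebesgue_rV n, forall u, U u -> g u = 0} -> forall u, U u -> g u = 0.
Proof.
move=> cg oU [N [mN N0 sN]] u Uu; apply: contrapT => gu.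
have oV : open (U `&` g @^-1` [set y | y != 0]).
  by apply: openI => //; apply: open_comp => [? _|]; [exact: cg|exact: open_neq].
have [e e0 eV] := open_box oV (conj Uu (introN eqP gu)).
have := @lebesgue_rV_box_gt0 n (fun i => u 0 i - e) (fun i => u 0 i + e).
rewrite ltNge => /(_ _)/negP; apply => [i|]; first lra.
rewrite -N0 le_measure ?inE //; first exact: measurable_box.
by move=> x /eV [Ux /eqP gx]; apply: sN => /= /(_ Ux).
Qed.

End lebesgue_rV_null.

(** * Barycentric coordinates, subsimplices and barycenters *)

Section barycentric.
Context {R : realType} {d : nat}.
Variable v : 'I_d.+1 -> 'rV[R]_d.

Let vmx : 'M[R]_(1 + d) := \matrix_(k < 1 + d) row_mx 1%:M (v k).

(** Weights times the matrix inverted in [bary] give the total weight and the weighted point, which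
    turns identities between barycentric coordinates into inversions of [vmx]. *)
Lemma mul_row_vmx (c : 'I_d.+1 -> R) :
  (\row_i c i) *m vmx = row_mx (\sum_i c i)%:M (\sum_i c i *: v i).
Proof.
rewrite mulmx_sum_row -[LHS]hsubmxK !linear_sum; congr row_mx; last first.
  by apply: eq_bigr => i _; rewrite mxE linearZ /= rowK row_mxKr.
apply/rowP => j; rewrite ord1 summxE !mxE mulr1n; apply: eq_bigr => i _.
by rewrite linearZ /= rowK row_mxKl !mxE mulr1.
Qed.

Hypothesis hv : nondegenerate_simplex v.

(** A vector in the kernel consists of weights with sum 0 that combine the vertices to 0;
    eliminating the first weight leaves a linear relation between the edges from [v ord0]. *)
Lemma vmx_unit : vmx \in unitmx.
Proof.
rewrite -row_free_unit; apply: inj_row_free => u.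
rewrite (_ : u = \row_i u 0 i); last by apply/rowP => i; rewrite mxE.
rewrite mul_row_vmx -row_mx0 => /eq_row_mx [/rowP/(_ 0)].
rewrite !mxE mulr1n big_ord_recl => /eqP; rewrite addr_eq0 => /eqP u0 s0.
have : (\row_i u 0 (lift ord0 i)) *m edge_mx v = 0.
  rewrite mulmx_sum_row -[RHS]s0 [RHS]big_ord_recl u0 scaleNr scaler_suml.
  rewrite -sumrN -big_split; apply: eq_bigr => i _ /=.
  by rewrite mxE rowK scalerBr addrC.
move=> /eqP; rewrite mulmx_free_eq0 // => /eqP /rowP h.
have {}h i : u 0 (lift ord0 i) = 0 by have := h i; rewrite !mxE.
rewrite row_mx0; apply/rowP => i; rewrite !mxE.
case: (unliftP ord0 i) => [k|] ->; first exact: h.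
by rewrite u0 big1 ?oppr0.
Qed.

Lemma row_bary x : \row_i bary v i x = row_mx 1%:M x *m invmx vmx.
Proof. by apply/rowP => i; rewrite mxE. Qed.

Lemma bary_sum x :
  \sum_i bary v i x = 1 /\ \sum_i bary v i x *: v i = x.
Proof.
have := mul_row_vmx (bary v ^~ x); rewrite row_bary mulmxKV ?vmx_unit //.
move=> /eq_row_mx [/rowP/(_ 0)]; rewrite !mxE !mulr1n => <- <-.
by [].
Qed.

Lemma sum_bary x : \sum_i bary v i x = 1.
Proof. by have [] := bary_sum x. Qed.

Lemma sum_baryZ x : \sum_i bary v i x *: v i = x.
Proof. by have [] := bary_sum x. Qed.

Lemma bary_comb (c : 'I_d.+1 -> R) i : \sum_i c i = 1 ->
  bary v i (\sum_k c k *: v k) = c i.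
Proof.
move=> c1; have := mul_row_vmx c; rewrite c1.
move=> /(congr1 (mulmx^~ (invmx vmx))); rewrite mulmxK ?vmx_unit // -row_bary.
by move=> /rowP /(_ i); rewrite !mxE.
Qed.

Lemma bary_affine i : exists a (b : 'I_d -> R),
  forall x, bary v i x = a + \sum_k x 0 k * b k.
Proof.
exists (invmx vmx (lshift d 0) i), (fun k => invmx vmx (rshift 1 k) i) => x.
rewrite /bary mxE big_split_ord /= big_ord1; congr (_ + _).
  by rewrite row_mxEl mxE mul1r.
by apply: eq_bigr => k _; rewrite row_mxEr.
Qed.

Lemma simplexE : simplex v = [set x | forall i, 0 <= bary v i x].
Proof.
apply/seteqP; split => x /=.
  by move=> [c [c0 c1 ->]] i; rewrite bary_comb.
by move=> x0; exists (bary v ^~ x); rewrite sum_bary sum_baryZ.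
Qed.

Lemma bary_le1 x i : simplex v x -> bary v i x <= 1.
Proof.
rewrite simplexE => x0; rewrite -(sum_bary x) (bigD1 i) //= lerDl.
exact: sumr_ge0.
Qed.

Lemma measurable_bary i : measurable_fun setT (bary v i).
Proof.
have [a [b E]] := bary_affine i; rewrite (funext E).
apply: measurable_funD => //; apply: measurable_sum => k.
by apply: measurable_funM => //; exact: measurable_coord.
Qed.

Lemma continuous_bary i : continuous (bary v i).
Proof.
have [a [b E]] := bary_affine i; rewrite (funext E) => x.
have := @continuousD _ _ _ (cst a)
  (fun x : 'rV[R]_d => \sum_k x 0 k * b k) x; apply.
  exact: cst_continuous.
apply: (@continuous_big _ _ +%R 0) => [|k _ {}x]; first exact: add_continuous.
apply: continuousM; first exact: coord_continuous.
exact: cst_continuous.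
Qed.

(** A common description of the simplex ([T] full) and of the face opposite [j] ([T] the complement
    of [j]), so that uniqueness of coefficients is proved once for both. [subsimplex_int] is its
    relative interior when [T] is nonempty. *)
Definition subsimplex (T : {set 'I_d.+1}) : set 'rV[R]_d :=
  [set x | forall i, if i \in T then 0 <= bary v i x else bary v i x == 0].

Definition subsimplex_int (T : {set 'I_d.+1}) : set 'rV[R]_d :=
  [set x | forall i, if i \in T then 0 < bary v i x else bary v i x == 0].

Lemma subsimplexT : subsimplex [set: 'I_d.+1]%SET = simplex v.
Proof.
by rewrite simplexE; apply/seteqP; split => x /= h i; have := h i;
  rewrite finset.in_setT.
Qed.

Lemma subsimplex_sub T : subsimplex T `<=` simplex v.
Proof.
move=> x Tx; rewrite simplexE => i.
by have := Tx i; case: ifP => // _ /eqP ->.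
Qed.

Lemma subsimplex_int_sub T : subsimplex_int T `<=` subsimplex T.
Proof. by move=> x Tx i; have := Tx i; case: ifP => // _ /ltW. Qed.

Lemma measurable_subsimplex T : measurable (subsimplex T).
Proof.
rewrite (_ : subsimplex T = \bigcap_(i : 'I_d.+1)
  (bary v i @^-1` (if i \in T then `[0, +oo[%classic else [set 0]))); last first.
  apply/seteqP; split => x /= h i; [move=> _ /=; have := h i|
      have := h i Logic.I => /=]; case: ifP => _ /=;
    rewrite ?in_itv /= ?andbT //; [by move/eqP|by move=> ->].
apply: fin_bigcap_measurable => // i _; rewrite -[X in measurable X]setTI.
apply: measurable_bary => //; case: ifP => _; first exact: measurable_itv.
exact: measurable_set1.
Qed.

Lemma subsimplex_int_interior :
  subsimplex_int [set: 'I_d.+1]%SET `<=` interior (simplex v).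
Proof.
move=> x xT; rewrite simplexE.
apply: (@filter_forall _ _ (fun i => [set y | 0 <= bary v i y]) (nbhs x)) => i.
have := xT i; rewrite finset.in_setT => x0.
have h : nbhs (bary v i x) [set y | 0 < y].
  by apply: open_nbhs_nbhs; split => //; exact: open_gt.
have {}h : nbhs x [set y | 0 < bary v i y] := @continuous_bary i x _ h.
have := @filterS _ (nbhs x) _ _ [set y | 0 <= bary v i y] _ h.
by apply=> y /=; exact: ltW.
Qed.

End barycentric.

Section barycenter.
Context {R : realType} {d : nat}.
Variable v : 'I_d.+1 -> 'rV[R]_d.
Hypothesis hv : nondegenerate_simplex v.

Definition barycenter (A : {set 'I_d.+1}) : 'rV[R]_d :=
  \sum_k (if k \in A then #|A|%:R^-1 else 0) *: v k.

Lemma bary_barycenter (A : {set 'I_d.+1}) i : A != finset.set0 ->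
  bary v i (barycenter A) = if i \in A then #|A|%:R^-1 else 0.
Proof.
move=> A0; rewrite bary_comb // -big_mkcond /= sumr_const -[LHS]mulr_natr.
by rewrite mulVf // pnatr_eq0 -lt0n card_gt0.
Qed.

Lemma bary_segment t x y i :
  bary v i ((1 - t) *: x + t *: y) = (1 - t) * bary v i x + t * bary v i y.
Proof.
rewrite -{1}(sum_baryZ hv x) -{1}(sum_baryZ hv y) !scaler_sumr -big_split /=.
under eq_bigr do rewrite !scalerA -scalerDl.
rewrite bary_comb // big_split /= -!mulr_sumr !sum_bary //; ring.
Qed.

End barycenter.

(** * Faces and their affine parametrization *)

Section faces.
Context {R : realType} {d : nat}.
Variable v : 'I_d.+2 -> 'rV[R]_d.+1.
Hypothesis hv : nondegenerate_simplex v.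
Variable j : 'I_d.+2.

(** The ambient dimension is a successor here, so that the index type ['I_d.-1.+1] of [face_vertex]
    reduces and [lift j] can be used. *)
Lemma face_vertexE i : face_vertex v j i = v (lift j i).
Proof. by congr v; apply: val_inj; rewrite /= inordK // (ltn_ord (lift j i)). Qed.

Lemma face_comb (c : 'I_d.+1 -> R) :
  let c' k := oapp c 0 (unlift j k) in
  \sum_k c' k = \sum_i c i /\
  \sum_i c i *: face_vertex v j i = \sum_k c' k *: v k.
Proof.
split.
  rewrite (bigD1_ord j) //= unlift_none add0r.
  by apply: eq_bigr => i _; rewrite liftK.
rewrite [RHS](bigD1_ord j) //= unlift_none scale0r add0r.
by apply: eq_bigr => i _; rewrite liftK face_vertexE.
Qed.

Lemma face_baryE x : bary v j x = 0 ->
  \sum_i bary v (lift j i) x = 1 /\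
  \sum_i bary v (lift j i) x *: face_vertex v j i = x.
Proof.
move=> xj; split.
  by rewrite -[RHS](sum_bary hv x) (bigD1_ord j) //= xj add0r.
rewrite -[RHS](sum_baryZ hv x) (bigD1_ord j) //= xj scale0r add0r.
by apply: eq_bigr => i _; rewrite face_vertexE.
Qed.

Lemma bary_face_comb (c : 'I_d.+1 -> R) k : \sum_i c i = 1 ->
  bary v k (\sum_i c i *: face_vertex v j i) = oapp c 0 (unlift j k).
Proof.
by move=> c1; have [s1 ->] := face_comb c; rewrite bary_comb // s1.
Qed.

Lemma faceE : face v j = subsimplex v [set~ j]%SET.
Proof.
apply/seteqP; split => x /=.
  move=> [c [c0 c1 ->]] i; rewrite bary_face_comb //.
  by case: (unliftP j i) => [k|] ->; rewrite !inE ?eqxx //= eq_sym neq_lift /=.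
move=> h; have /eqP xj : bary v j x == 0 by have := h j; rewrite !inE eqxx.
have [s1 sx] := face_baryE xj.
exists (fun i => bary v (lift j i) x); split => // i.
by have := h (lift j i); rewrite !inE eq_sym neq_lift.
Qed.

(** The entries of [u] are the weights of the face vertices other than the first, which takes the
    remaining weight; the parametrization is thus barycentric. *)
Lemma affine_paramE (u : 'rV[R]_d) :
  let c i := oapp (u 0) (1 - \sum_k u 0 k) (unlift ord0 i) in
  \sum_i c i = 1 /\
  affine_param (face_vertex v j) u = \sum_i c i *: face_vertex v j i.
Proof.
split.
  rewrite big_ord_recl /= unlift_none /=.
  by under [X in _ + X]eq_bigr do rewrite liftK /=; rewrite subrK.
rewrite [RHS]big_ord_recl /= unlift_none /=.
rewrite /affine_param mulmx_sum_row scalerBl scale1r -addrA; congr (_ + _).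
rewrite scaler_suml -sumrN -big_split; apply: eq_bigr => i _ /=.
by rewrite liftK rowK scalerBr addrC.
Qed.

Lemma bary_affine_param u : bary v j (affine_param (face_vertex v j) u) = 0.
Proof.
by have [c1 ->] := affine_paramE u; rewrite bary_face_comb // unlift_none.
Qed.

Lemma affine_param_surj x : bary v j x = 0 ->
  exists u, x = affine_param (face_vertex v j) u.
Proof.
move=> xj; have [s1 sx] := face_baryE xj.
exists (\row_i bary v (lift j (lift ord0 i)) x).
have [_ ->] := affine_paramE (\row_i bary v (lift j (lift ord0 i)) x).
rewrite -[LHS]sx; apply: eq_bigr => i _; congr (_ *: _).
case: (unliftP ord0 i) => [k|] -> /=; first by rewrite mxE.
rewrite -s1 big_ord_recl; under [X in _ - X]eq_bigr do rewrite mxE.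
by rewrite addrK.
Qed.

Lemma continuous_bary_affine_param i :
  continuous (fun u => bary v i (affine_param (face_vertex v j) u)).
Proof.
rewrite (_ : (fun _ => _) = fun u : 'rV[R]_d => oapp (fun k =>
    oapp (u 0) (1 - \sum_k u 0 k) (unlift ord0 k)) 0 (unlift j i)); last first.
  apply/funext => u; have [c1 ->] := affine_paramE u.
  by rewrite bary_face_comb.
case: unliftP => [k|] _ /=; last exact: cst_continuous.
case: unliftP => [l|] _ /=; first exact: coord_continuous.
move=> u; have := @continuousB _ _ _ (cst (1 : R)) (fun u : 'rV[R]_d => \sum_k u 0 k) u.
apply; first exact: cst_continuous.
apply: (@continuous_big _ _ +%R 0) => [|l _]; first exact: add_continuous.
exact: coord_continuous.
Qed.

End faces.

(** * Square-free monomials in the barycentric coordinates *)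

Section barycentric_monomials.
Context {R : realType} {d : nat}.
Variable v : 'I_d.+1 -> 'rV[R]_d.
Hypothesis hv : nondegenerate_simplex v.
Local Notation E := ('rV[R]_d -> R).

Definition bmono (A : {set 'I_d.+1}) : E := fun x => \prod_(a in A) bary v a x.

(** A singleton stands for a coordinate and a pair for a product of two distinct ones; together they
    index a basis of the polynomials of degree at most 2 on [subsimplex T]. *)
Definition bidx (T : {set 'I_d.+1}) : {set {set 'I_d.+1}} :=
  [set A : {set 'I_d.+1} | (A \subset T) && (0 < #|A| <= 2)%N]%SET.

(* No squares are needed: the [bary v i] sum to 1. *)
Definition bpoly T (u : 'rV[R]_#|bidx T|) : E :=
  fun x => \sum_i u 0 i * bmono (enum_val i) x.

Lemma bidxP T (i : 'I_#|bidx T|) :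
  [/\ enum_val i \subset T, (0 < #|enum_val i|)%N & (#|enum_val i| <= 2)%N].
Proof. by have := enum_valP i; rewrite inE => /and3P []. Qed.

Lemma bmono1 a x : bmono [set a]%SET x = bary v a x.
Proof. by rewrite /bmono big_set1. Qed.

Lemma bmono2 a b x : a != b ->
  bmono [set a; b]%SET x = bary v a x * bary v b x.
Proof. by move=> ab; rewrite /bmono big_setU1 ?big_set1 // inE. Qed.

(* This is the vanishing of the third difference along a segment. *)
Lemma bmono_segment (A : {set 'I_d.+1}) x y : (0 < #|A| <= 2)%N ->
  let z t := (1 - t) *: x + t *: y in
  bmono A y = bmono A x - 3 * bmono A (z 3^-1) + 3 * bmono A (z (2 / 3)).
Proof.
move=> /= A2; have : (#|A| == 1%N) || (#|A| == 2%N).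
  by move: A2; case: #|A| => [|[|[]]].
case/orP => [/cards1P [a ->]|/cards2P [a [b [ab ->]]]].
  by rewrite !bmono1 !bary_segment //; field.
by rewrite !bmono2 // !bary_segment //; field.
Qed.

Lemma bpoly_segment T (u : 'rV[R]_#|bidx T|) x y :
  let z t := (1 - t) *: x + t *: y in
  bpoly u y = bpoly u x - 3 * bpoly u (z 3^-1) + 3 * bpoly u (z (2 / 3)).
Proof.
move=> z; rewrite /bpoly !mulr_sumr -sumrN -!big_split; apply: eq_bigr => i _ /=.
have [_ ? ?] := bidxP i; rewrite (@bmono_segment _ x y) -/z; last exact/andP.
ring.
Qed.

(** On the segment from the barycenter of [T] to [x], every point but possibly [x] lies in the
    relative interior. The values at the parameters 0, 1/3 and 2/3 therefore vanish, and they
    determine the value at 1. *)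
Lemma bpoly_closure T (u : 'rV[R]_#|bidx T|) : T != finset.set0 ->
  (forall x, subsimplex_int v T x -> bpoly u x = 0) ->
  forall x, subsimplex v T x -> bpoly u x = 0.
Proof.
move=> T0 h x Tx; pose c := barycenter v T.
have cT : subsimplex_int v T c.
  move=> i; rewrite /c bary_barycenter //; case: (i \in T); last exact: eqxx.
  by rewrite invr_gt0 ltr0n card_gt0.
have zT t : 0 <= t < 1 -> subsimplex_int v T ((1 - t) *: c + t *: x).
  move=> t01 i; rewrite bary_segment //.
  have := Tx i; have := cT i; case: ifP => _ => [c0 x0|/eqP -> /eqP ->].
    have [t0 t1] := andP t01; rewrite ltr_wpDr ?mulr_ge0 //.
    by rewrite mulr_gt0 // subr_gt0.
  by rewrite !mulr0 addr0.
by rewrite (bpoly_segment u c x) !h //; [ring|apply: zT; lra..].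
Qed.

Lemma subsimplex_barycenter (A T : {set 'I_d.+1}) : A != finset.set0 ->
  A \subset T -> subsimplex v T (barycenter v A).
Proof.
move=> A0 /fintype.subsetP AT i; rewrite bary_barycenter //.
case: ifP => [_|iT]; first by case: ifP => // _; rewrite invr_ge0.
by rewrite ifF //; apply: contraFF iT; exact: AT.
Qed.

(** Evaluation at the barycenter of [A] kills each monomial not contained in [A]; the proper subsets
    of [A] have coefficient 0 by induction on the cardinality, so only the coefficient of [A]
    survives. *)
Lemma bpoly_free T (u : 'rV[R]_#|bidx T|) :
  (forall x, subsimplex v T x -> bpoly u x = 0) -> u = 0.
Proof.
move=> h; suff H n (i : 'I_#|bidx T|) : (#|enum_val i| <= n)%N -> u 0 i = 0.
  by apply/rowP => i; rewrite mxE; exact: (H _ i (leqnn _)).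
elim: n i => [|n IHn] i.
  by have [_] := bidxP i; case: #|_|.
move=> An; have [AT A0 _] := bidxP i; set A := enum_val i in An AT A0.
have {}A0 : A != finset.set0 by rewrite -card_gt0.
have := h _ (subsimplex_barycenter A0 AT).
rewrite /bpoly (bigD1 i) //= big1 ?addr0 => [|k ki].
  move=> /eqP; rewrite mulf_eq0 => /orP [/eqP //|].
  rewrite /bmono prodf_seq_eq0 => /hasP [a _ /andP [aA]].
  by rewrite bary_barycenter // aA invr_eq0 pnatr_eq0 cards_eq0 (negbTE A0).
have [kA|] := boolP (enum_val k \subset A).
  rewrite IHn ?mul0r // -ltnS; apply: leq_trans An; apply: proper_card.
  rewrite finset.properEneq kA andbT; apply: contra ki => /eqP.
  by move=> /enum_val_inj ->.
move=> /fintype.subsetPn [a ak aA]; rewrite /bmono (bigD1 a) //= bary_barycenter //.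
by rewrite (negbTE aA) mul0r mulr0.
Qed.

(** The inner map [f] allows both the identity, for the simplex, and the parametrization of a
    face. *)
Lemma continuous_prod_bary (X : topologicalType) (f : X -> 'rV[R]_d) A :
  (forall i, continuous (fun x => bary v i (f x))) ->
  continuous (fun x => bmono A (f x)).
Proof.
move=> cf; rewrite /bmono.
have := @continuous_big _ _ (@GRing.mul R) 1 (fun a => a \in A) _ X
  (index_enum _) (fun i x => bary v i (f x)).
apply => [|i _]; last exact: cf.
exact: mul_continuous.
Qed.

Lemma continuous_bpoly (X : topologicalType) (f : X -> 'rV[R]_d) T
    (u : 'rV[R]_#|bidx T|) :
  (forall i, continuous (fun x => bary v i (f x))) ->
  continuous (fun x => bpoly u (f x)).
Proof.
move=> cf; rewrite /bpoly; apply: (@continuous_big _ _ +%R 0) => [|i _ x].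
  exact: add_continuous.
have := @continuousM _ _ (cst (u 0 i)) (fun x => bmono (enum_val i) (f x)) x.
apply; first exact: cst_continuous.
exact: continuous_prod_bary.
Qed.

Lemma measurable_bmono A : measurable_fun setT (bmono A).
Proof.
rewrite (_ : bmono A = fun x => \prod_i (if i \in A then bary v i x else 1)).
  by apply: measurable_prod => i _; case: (i \in A) => //; exact: measurable_bary.
by apply/funext => x; rewrite /bmono big_mkcond.
Qed.

Lemma bmono_le1 A x : simplex v x -> `|bmono A x| <= 1.
Proof.
move=> Sx; have x0 : forall i, 0 <= bary v i x by move: Sx; rewrite simplexE.
rewrite ger0_norm ?prodr_ge0 //; apply: prodr_ile1 => i _.
by rewrite x0 bary_le1.
Qed.

End barycentric_monomials.

(** * Polynomials of degree at most 2 as combinations of barycentric monomials *)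

Section polynomial_functions.
Context {R : realType} {d : nat}.
Variable v : 'I_d.+1 -> 'rV[R]_d.
Hypothesis hv : nondegenerate_simplex v.
Local Notation E := ('rV[R]_d -> R).

(** Unlike in [poly_space], the function is not cut off outside a set, so that constants, sums and
    products stay pointwise. *)
Definition poly_fun k (f : E) := exists2 p : mpoly d R,
  (msize p <= k.+1)%N & forall x, f x = meval (x ord0) p.

Lemma poly_fun_cst k c : poly_fun k (fun=> c).
Proof.
exists (mpolyC d c); first by rewrite msizeC (leq_trans (leq_b1 _)).
by move=> x; rewrite mevalC.
Qed.

Lemma poly_funD k f g : poly_fun k f -> poly_fun k g ->
  poly_fun k (fun x => f x + g x).
Proof.
move=> [p pk fE] [q qk gE]; exists (p + q) => [|x]; last by rewrite mevalD fE gE.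
by rewrite (leq_trans (msizeD_le _ _)) // geq_max pk.
Qed.

Lemma poly_funM k l f g : poly_fun k f -> poly_fun l g ->
  poly_fun (k + l) (fun x => f x * g x).
Proof.
move=> [p pk fE] [q ql gE]; exists (p * q) => [|x]; last by rewrite mevalM fE gE.
have [->|p0] := eqVneq p 0; first by rewrite mul0r msize0.
have [->|q0] := eqVneq q 0; first by rewrite mulr0 msize0.
rewrite msizeM // -subn1 leq_subLR add1n -addSn -addnS; exact: leq_add.
Qed.

Lemma poly_funZ k c f : poly_fun k f -> poly_fun k (fun x => c * f x).
Proof. exact: poly_funM (poly_fun_cst 0 c). Qed.

Lemma poly_fun_sum k (I : finType) (F : I -> E) :
  (forall i, poly_fun k (F i)) -> poly_fun k (fun x => \sum_i F i x).
Proof.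
move=> h; elim: (index_enum I) => [|i s IHs].
  by have [p pk pE] := poly_fun_cst k 0; exists p => // x; rewrite big_nil -pE.
have [p pk pE] := poly_funD (h i) IHs.
by exists p => // x; rewrite big_cons -pE.
Qed.

Lemma poly_fun_coord i : poly_fun 1 (fun x => x 0 i).
Proof.
exists (mpolyX R (mnm1 i)) => [|x]; last by rewrite mevalXU.
by rewrite msizeX mdeg1.
Qed.

Lemma poly_fun_bary i : poly_fun 1 (bary v i).
Proof.
have [a [b ab]] := bary_affine v i.
have [||p pk pE] := @poly_funD 1 (fun=> a) (fun x => \sum_k x 0 k * b k).
- exact: poly_fun_cst.
- apply: poly_fun_sum => k.
  by apply: (@poly_funM 1 0); [exact: poly_fun_coord|exact: poly_fun_cst].
- by exists p => // x; rewrite ab -pE.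
Qed.

Lemma poly_fun_bmono (A : {set 'I_d.+1}) : (0 < #|A| <= 2)%N ->
  poly_fun 2 (bmono v A).
Proof.
move=> A2; have : (#|A| == 1%N) || (#|A| == 2%N).
  by move: A2; case: #|A| => [|[|[]]].
case/orP => [/cards1P [a ->]|/cards2P [a [b [ab ->]]]].
  have [p pk pE] := poly_fun_bary a.
  by exists p => [|x]; [rewrite (leq_trans pk)|rewrite bmono1].
have [p pk pE] := poly_funM (poly_fun_bary a) (poly_fun_bary b).
by exists p => // x; rewrite bmono2.
Qed.

Lemma poly_fun_bpoly T (u : 'rV[R]_#|bidx T|) : poly_fun 2 (bpoly v u).
Proof.
apply: poly_fun_sum => i; apply: poly_funZ; apply: poly_fun_bmono.
by have [_ -> ->] := bidxP i.
Qed.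

(** These are the affine functions: the coordinates sum to 1, so a constant term is absorbed. *)
Definition bary_linear (f : E) :=
  exists a : 'I_d.+1 -> R, forall x, f x = \sum_i a i * bary v i x.

Lemma bary_linear_cst c : bary_linear (fun=> c).
Proof. by exists (fun=> c) => x; rewrite -mulr_sumr sum_bary ?mulr1. Qed.

Lemma bary_linear_coord k : bary_linear (fun x => x 0 k).
Proof.
exists (fun i => v i 0 k) => x; rewrite -[in LHS](sum_baryZ hv x) summxE.
by apply: eq_bigr => i _; rewrite mxE mulrC.
Qed.

Definition bary_quadratic (f : E) :=
  exists u : 'rV[R]_#|bidx [set: 'I_d.+1]%SET|, forall x, f x = bpoly v u x.

Lemma bary_quadraticD f g : bary_quadratic f -> bary_quadratic g ->
  bary_quadratic (fun x => f x + g x).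
Proof.
move=> [u uE] [w wE]; exists (u + w) => x; rewrite uE wE -big_split.
by apply: eq_bigr => i _; rewrite mxE mulrDl.
Qed.

Lemma bary_quadraticZ c f : bary_quadratic f ->
  bary_quadratic (fun x => c * f x).
Proof.
move=> [u uE]; exists (c *: u) => x; rewrite uE mulr_sumr.
by apply: eq_bigr => i _; rewrite mxE mulrA.
Qed.

Lemma bary_quadratic_sum (I : Type) (r : seq I) (P : pred I) (F : I -> E) :
  (forall i, P i -> bary_quadratic (F i)) ->
  bary_quadratic (fun x => \sum_(i <- r | P i) F i x).
Proof.
move=> h; elim: r => [|i s [u uE]].
  by exists 0 => x; rewrite big_nil /bpoly big1 // => i _; rewrite mxE mul0r.
case Pi : (P i); last by exists u => x; rewrite big_cons Pi.
have [w wE] := bary_quadraticD (h _ Pi) (ex_intro _ u uE).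
by exists w => x; rewrite big_cons Pi wE.
Qed.

Lemma bary_quadratic_bmono (A : {set 'I_d.+1}) : (0 < #|A| <= 2)%N ->
  bary_quadratic (bmono v A).
Proof.
move=> A2; have AI : A \in bidx [set: 'I_d.+1]%SET by rewrite inE finset.subsetT.
exists (\row_i (i == enum_rank_in AI A)%:R) => x; rewrite /bpoly.
rewrite (bigD1 (enum_rank_in AI A)) //= big1 ?addr0 => [|i /negbTE ij].
  by rewrite mxE eqxx mul1r enum_rankK_in.
by rewrite mxE ij mul0r.
Qed.

Lemma bary_quadratic_bary i : bary_quadratic (bary v i).
Proof.
have [|u uE] := @bary_quadratic_bmono [set i]%SET; first by rewrite cards1.
by exists u => x; rewrite -uE bmono1.
Qed.

(** A square is removed by [lambda_i^2 = lambda_i - \sum_(a != i) lambda_i lambda_a]. *)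
Lemma bary_quadratic_mul_bary i k :
  bary_quadratic (fun x => bary v i x * bary v k x).
Proof.
have neq a b : a != b -> bary_quadratic (fun x => bary v a x * bary v b x).
  move=> ab; have [|u uE] := @bary_quadratic_bmono [set a; b]%SET.
    by rewrite cards2 ab.
  by exists u => x; rewrite -uE bmono2.
have [<-|/neq //] := eqVneq i k.
have h : bary_quadratic (fun x => \sum_(a | a != i) bary v i x * bary v a x).
  by apply: bary_quadratic_sum => a; rewrite eq_sym; exact: neq.
have [u uE] := bary_quadraticD (bary_quadratic_bary i) (bary_quadraticZ (-1) h).
exists u => x; rewrite -uE -mulr_sumr.
have := sum_bary hv x; rewrite (bigD1 i) //= => /eqP.
rewrite addrC eq_sym -subr_eq => /eqP <-.
ring.
Qed.

Lemma bary_linear_mul f g : bary_linear f -> bary_linear g ->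
  bary_quadratic (fun x => f x * g x).
Proof.
move=> [a aE] [b bE].
have [|u uE] := @bary_quadratic_sum _ (index_enum 'I_d.+1) xpredT (fun i x =>
    \sum_k (a i * b k) * (bary v i x * bary v k x)).
  move=> i _; apply: bary_quadratic_sum => k _.
  exact/bary_quadraticZ/bary_quadratic_mul_bary.
exists u => x; rewrite -uE aE bE mulr_suml; apply: eq_bigr => i _.
by rewrite mulr_sumr; apply: eq_bigr => k _; ring.
Qed.

Lemma mdegS k (m : multinom d) : mdeg m = k.+1 ->
  exists i m', m = mnm_add m' (mnm1 i) /\ mdeg m' = k.
Proof.
move=> mk; have /eqP : mdeg m <> 0%N by rewrite mk.
rewrite mdegE sum_nat_eq0 negb_forall => /existsP [i /= mi].
exists i, (mnm_sub m (mnm1 i)); have h := submK (etrans (lep1mP i m) mi).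
by rewrite h; split => //; move: mk; rewrite -{1}h mdegD mdeg1 addn1 => -[].
Qed.

Lemma meval_monomial_linear (m : multinom d) : (mdeg m <= 1)%N ->
  bary_linear (fun x => meval (x ord0) (mpolyX R m)).
Proof.
case mk : (mdeg m) => [|[]] // _.
  move/eqP : mk; rewrite mdeg_eq0 => /eqP ->.
  have [a aE] := bary_linear_cst 1; exists a => x.
  by rewrite mpolyX0 meval1 -aE.
have /mdeg1P [i /eqP ->] : mdeg m == 1%N by rewrite mk.
have [a aE] := bary_linear_coord i; exists a => x.
by rewrite mevalXU aE.
Qed.

Lemma bary_linear_poly f : poly_fun 1 f -> bary_linear f.
Proof.
move=> [p p1 fE].
(* The support condition stands under the existential so that [choice] yields coefficients for all
   [m] at once. *)
have h (m : multinom d) : exists a : 'I_d.+1 -> R, m \in msupp p ->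
    forall x : 'rV_d, meval (x ord0) (mpolyX R m) = \sum_i a i * bary v i x.
  have [mp|_] := boolP (m \in msupp p); last by exists (fun=> 0).
  have [|a aE] := @meval_monomial_linear m; last by exists a.
  by rewrite -ltnS; apply: leq_trans p1; exact: msize_mdeg_lt.
have [a aE] := choice h.
exists (fun i => \sum_(m <- msupp p) mcoeff m p * a m i) => x.
rewrite fE [p in LHS]mpolyE raddf_sum /=.
under [RHS]eq_bigr do rewrite mulr_suml.
rewrite exchange_big big_seq [RHS]big_seq; apply: eq_bigr => m mp.
rewrite mevalZ aE // mulr_sumr; apply: eq_bigr => i _; exact: mulrA.
Qed.

(** Every monomial of degree at most 2 is a product of two affine functions: a factor of degree 1
    times a coordinate, or a monomial of degree at most 1 times the constant 1. *)
Lemma bary_quadratic_poly f : poly_fun 2 f -> bary_quadratic f.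
Proof.
move=> [p p2 fE].
have [|u uE] := @bary_quadratic_sum _ (msupp p) (fun m => m \in msupp p)
    (fun m x => mcoeff m p * meval (x ord0) (mpolyX R m)); last first.
  exists u => x; rewrite -uE fE [p in LHS]mpolyE raddf_sum /= big_seq.
  by apply: eq_bigr => m _; rewrite mevalZ.
move=> m mp; apply: bary_quadraticZ.
have : (mdeg m <= 2)%N.
  by rewrite -ltnS; apply: leq_trans p2; exact: msize_mdeg_lt.
rewrite leq_eqVlt => /orP [/eqP/mdegS [i [m' [-> m1]]]|m1].
  have [|u uE] := bary_linear_mul (@meval_monomial_linear m' _) (bary_linear_coord i).
    by rewrite m1.
  by exists u => x; rewrite mpolyXD mevalM mevalXU -uE.
have [u uE] := bary_linear_mul (meval_monomial_linear m1) (bary_linear_cst 1).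
by exists u => x; rewrite -uE mulr1.
Qed.

End polynomial_functions.

(** * Weighted inner products and their Gram matrices *)

Section weighted_inner_product.
Context {R : realType} {d : nat}.
Variables (mu : {measure set 'rV[R]_d -> \bar R}) (X : set 'rV[R]_d).
Variable w : 'rV[R]_d -> R.
Hypothesis mX : measurable X.
Hypothesis hw : prob_density mu X w.
Local Notation E := ('rV[R]_d -> R).
Local Notation ip := (weighted_inner mu X w).

(** The density is only integrable, so boundedness of the other factors is what keeps the weighted
    products integrable. *)
Definition bounded_measurable (f : E) :=
  measurable_fun X f /\ exists M, forall x, X x -> `|f x| <= M.

Lemma bounded_measurableM f g : bounded_measurable f -> bounded_measurable g ->
  bounded_measurable (fun x => f x * g x).
Proof.
move=> [mf [M Mf]] [mg [N Ng]]; split; first exact: measurable_funM.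
by exists (M * N) => x Xx; rewrite normrM ler_pM ?Mf ?Ng.
Qed.

Lemma integrable_weighted f : bounded_measurable f ->
  mu.-integrable X (EFin \o (fun x => f x * w x)).
Proof.
move=> [mf [M Mf]].
have bf : [bounded f x | x in X].
  exists M; split; first exact: num_real.
  by move=> y My x Xx /=; rewrite (le_trans (Mf x Xx)) // ltW.
have := @integrableMr _ _ _ mu _ mX f (EFin \o w) mf bf.
by case: hw => iw _ _ /(_ iw).
Qed.

Lemma weighted_innerC f g : ip f g = ip g f.
Proof. by apply: eq_Rintegral => x _; rewrite (mulrC (f x)). Qed.

Lemma eq_weighted_inner f f' g g' : {in X, f =1 f'} -> {in X, g =1 g'} ->
  ip f g = ip f' g'.
Proof. by move=> ff gg; apply: eq_Rintegral => x Xx; rewrite ff ?gg. Qed.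

Lemma weighted_inner_suml n (a : 'I_n -> R) (F : 'I_n -> E) g :
  (forall i, bounded_measurable (F i)) -> bounded_measurable g ->
  ip (fun x => \sum_i a i * F i x) g = \sum_i a i * ip (F i) g.
Proof.
move=> bF bg; have iF i := integrable_weighted (bounded_measurableM (bF i) bg).
(* Integrability of the partial sums is carried along, since additivity of the integral asks for it
   at each step. *)
have h (s : seq 'I_n) :
    mu.-integrable X
      (EFin \o (fun x => (\sum_(i <- s) a i * F i x) * g x * w x)) /\
    ip (fun x => \sum_(i <- s) a i * F i x) g = \sum_(i <- s) a i * ip (F i) g.
  elim: s => [|i s [IH1 IH2]].
    rewrite (_ : (fun _ => _) = cst 0); last first.
      by apply/funext => x; rewrite big_nil !mul0r.
    split; first exact: integrable0.
    rewrite big_nil /weighted_inner /Rintegral integral0_eq // => x _.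
    by rewrite big_nil !mul0r.
  have aF : mu.-integrable X (EFin \o (fun x => a i * (F i x * g x * w x))).
    have := @integrableZl _ _ _ mu _ mX (a i) _ (iF i); apply.
  have E x : (\sum_(k <- i :: s) a k * F k x) * g x * w x =
      a i * (F i x * g x * w x) + (\sum_(k <- s) a k * F k x) * g x * w x.
    by rewrite big_cons; ring.
  split.
    rewrite (funext E).
    by have := @integrableD _ _ _ mu _ mX _ _ aF IH1; apply.
  rewrite big_cons -IH2 /weighted_inner -RintegralZl // -RintegralD //.
  by apply: eq_Rintegral => x _; rewrite E.
by have [_] := h (index_enum 'I_n).
Qed.

(** [D] may be smaller than [X] because the density on the simplex is only known to be positive in
    the interior. *)
Lemma weighted_inner_gt0 (D : set 'rV[R]_d) f : D `<=` X ->
  {ae mu, forall x, D x -> 0 < w x} -> bounded_measurable f ->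
  ~ {ae mu, forall x, D x -> f x = 0} -> 0 < ip f f.
Proof.
move=> DX w0 bf f0; have iff := integrable_weighted (bounded_measurableM bf bf).
have mff := measurable_int mu iff.
(* The integrand is nonnegative only almost everywhere; with the absolute value inside, a zero
   integral forces it to vanish almost everywhere. *)
pose I := (\int[mu]_(x in X) `|(f x * f x * w x)%:E|)%E.
have IE : ip f f = fine I.
  congr fine; apply: ae_eq_integral => //; first exact: measurableT_comp.
  case: hw => _ + _; apply: filterS => x wx Xx /=.
  by rewrite ger0_norm // mulr_ge0 ?wx // -expr2 sqr_ge0.
have I0 : (0 <= I)%E by exact: integral_ge0.
have If : I \is a fin_num.
  by rewrite ge0_fin_numE //; case/integrableP: iff.
rewrite IE lt_neqAle fine_ge0 // andbT eq_sym fine_eq0 //.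
apply/eqP => /(ae_eq_integral_abs mu mX mff).1 ff0; apply: f0.
apply: filterS2 w0 ff0 => x wx fx Dx.
have := fx (DX _ Dx); move=> [] /eqP.
by rewrite !mulf_eq0 (gt_eqF (wx Dx)) orbF orbb => /eqP.
Qed.

Section Gram.
Variable v : 'I_d.+1 -> 'rV[R]_d.
Hypothesis hv : nondegenerate_simplex v.
Hypothesis XS : X `<=` simplex v.

Lemma bounded_measurable_bmono A : bounded_measurable (bmono v A).
Proof.
split; first by apply: measurable_funTS; exact: measurable_bmono.
by exists 1 => x /XS; exact: bmono_le1.
Qed.

Lemma bounded_measurable_bpoly T (u : 'rV[R]_#|bidx T|) :
  bounded_measurable (bpoly v u).
Proof.
split.
  apply: measurable_sum => i; apply: measurable_funM => //.
  by have [] := bounded_measurable_bmono (enum_val i).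
exists (\sum_i `|u 0 i|) => x Xx; apply: le_trans (ler_norm_sum _ _ _) _.
apply: ler_sum => i _; rewrite normrM ler_piMr //.
by apply: bmono_le1 => //; exact: XS.
Qed.

Definition bgram (T : {set 'I_d.+1}) : 'M[R]_#|bidx T| :=
  \matrix_(i, k) ip (bmono v (enum_val i)) (bmono v (enum_val k)).

Lemma weighted_inner_bpoly_bmono T (u : 'rV[R]_#|bidx T|) k :
  ip (bpoly v u) (bmono v (enum_val k)) = (u *m bgram T) 0 k.
Proof.
rewrite weighted_inner_suml; last 2 first.
- by move=> i; exact: bounded_measurable_bmono.
- exact: bounded_measurable_bmono.
by rewrite mxE; apply: eq_bigr => i _; rewrite mxE.
Qed.

Lemma weighted_inner_bpoly T (u u' : 'rV[R]_#|bidx T|) :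
  ip (bpoly v u) (bpoly v u') = (u *m bgram T *m u'^T) 0 0.
Proof.
rewrite weighted_innerC weighted_inner_suml; last 2 first.
- by move=> i; exact: bounded_measurable_bmono.
- exact: bounded_measurable_bpoly.
rewrite mxE; apply: eq_bigr => i _; rewrite weighted_innerC.
by rewrite weighted_inner_bpoly_bmono mulrC [u'^T _ _]mxE.
Qed.

Lemma posdefmx_bgram (D : set 'rV[R]_d) T : D `<=` X ->
  {ae mu, forall x, D x -> 0 < w x} ->
  (forall u : 'rV[R]_#|bidx T|,
    {ae mu, forall x, D x -> bpoly v u x = 0} -> u = 0) ->
  posdefmx (bgram T).
Proof.
move=> DX w0 h; split; first by apply/matrixP => i k; rewrite !mxE weighted_innerC.
move=> u /eqP u0; rewrite -weighted_inner_bpoly.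
by apply: (weighted_inner_gt0 DX w0); [exact: bounded_measurable_bpoly|
  apply: contra_not u0; exact: h].
Qed.

End Gram.
End weighted_inner_product.

(** * Definiteness on the simplex and on its faces, and dual functions *)

Section definiteness.
Context {R : realType} {d : nat}.

(** A quadratic that vanishes almost everywhere in the interior vanishes there by continuity, then
    on the whole simplex, and so has zero coefficients. *)
Lemma simplex_bgram_posdef (v : 'I_d.+1 -> 'rV[R]_d) (w : 'rV[R]_d -> R) :
  nondegenerate_simplex v -> prob_density (lebesgue_rV d) (simplex v) w ->
  {ae lebesgue_rV d, forall x, interior (simplex v) x -> 0 < w x} ->
  posdefmx (bgram (lebesgue_rV d) (simplex v) w v [set: 'I_d.+1]%SET).
Proof.
move=> hv hw w0; have mS : measurable (simplex v).
  by rewrite -subsimplexT //; exact: measurable_subsimplex.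
apply: (posdefmx_bgram mS hw hv _ _ w0) => // [|u u0]; first exact: interior_subset.
apply: (bpoly_free hv); apply: (bpoly_closure hv).
  by rewrite -card_gt0 cardsT card_ord.
move=> x /(subsimplex_int_interior hv); move: x.
apply: ae0_open_continuous u0; last exact: open_interior.
apply: (@continuous_bpoly _ _ v _ id) => i; exact: continuous_bary.
Qed.

(** If the volume element were 0, the surface measure would be 0 and no density could have integral
    1; no Gram determinant has to be computed. *)
Lemma surface_measure_factor_gt0 (n : nat) (f : 'I_n.+1 -> 'rV[R]_d)
    (X : set 'rV[R]_d) (w : 'rV[R]_d -> R) : measurable X -> prob_density (surface_measure f) X w ->
  0 < Num.sqrt (\det (edge_mx f *m (edge_mx f)^T)).
Proof.
move=> mX [iw _ w1]; rewrite lt_neqAle sqrtr_ge0 andbT eq_sym; apply/eqP => s0.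
have X0 : surface_measure f X = 0%E by rewrite /= /mscale /= s0 mul0e.
move: w1; rewrite /Rintegral (null_set_integral mX (measurable_int _ iw) X0) /= => /esym/eqP.
by rewrite oner_eq0.
Qed.

End definiteness.

Lemma measurable_face (R : realType) d (v : 'I_d.+1 -> 'rV[R]_d) j :
  nondegenerate_simplex v -> (0 < d)%N -> measurable (face v j).
Proof.
by case: d v j => // d v j hv _; rewrite faceE //; exact: measurable_subsimplex.
Qed.

Lemma face_sub (R : realType) d (v : 'I_d.+1 -> 'rV[R]_d) j :
  nondegenerate_simplex v -> (0 < d)%N -> face v j `<=` simplex v.
Proof.
by case: d v j => // d v j hv _; rewrite faceE //; exact: subsimplex_sub.
Qed.

Lemma face_bgram_posdef (R : realType) (d : nat) (v : 'I_d.+2 -> 'rV[R]_d.+1)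
    (j : 'I_d.+2) (w : 'rV[R]_d.+1 -> R) :
  nondegenerate_simplex v -> prob_density (face_measure v j) (face v j) w ->
  {ae face_measure v j, forall x, face v j x -> 0 < w x} ->
  posdefmx (bgram (face_measure v j) (face v j) w v [set~ j]%SET).
Proof.
move=> hv hw w0.
have mF := measurable_face j hv isT; have FS := @face_sub _ _ _ j hv isT.
apply: (posdefmx_bgram mF hw hv FS _ w0) => // u [N [mN N0 sN]].
have s0 := surface_measure_factor_gt0 mF hw.
pose g := affine_param (face_vertex v j).
(* The parameters of the relative interior of the face form an open set, to which the argument for
   the simplex is transported. *)
pose U := [set y | forall i, i != j -> 0 < bary v i (g y)].
have oU : open U.
  rewrite openE => y Uy.
  apply: (@filter_forall _ _ (fun i => [set y | i != j -> 0 < bary v i (g y)])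
    (nbhs y)) => i.
  have [->|ij] := eqVneq i j; first by apply: nearW.
  have h : nbhs (bary v i (g y)) [set r | 0 < r].
    by apply: open_nbhs_nbhs; split; [exact: open_gt|exact: Uy].
  have {}h : nbhs y [set z | 0 < bary v i (g z)] :=
    @continuous_bary_affine_param _ _ _ hv j i y _ h.
  have := @filterS _ (nbhs y) _ _ [set z | ~~ false -> 0 < bary v i (g z)] _ h.
  by apply=> z zp _; exact: zp.
have Ug y : U y -> subsimplex_int v [set~ j]%SET (g y).
  move=> Uy i.  rewrite !inE.  have [->|ij] := eqVneq i j; last exact: Uy.
  by rewrite /= bary_affine_param.
have gU0 : forall y, U y -> bpoly v u (g y) = 0.
  apply: ae0_open_continuous oU _.
    by apply: continuous_bpoly => i; exact: continuous_bary_affine_param.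
  (* The surface measure of [N] is the positive volume element times the Lebesgue measure of this
     preimage, which is therefore null. *)
  exists (g @^-1` N); split.
  - by rewrite -[X in measurable X]setTI; exact: measurable_affine_param.
  - move: N0; rewrite /= /mscale /= /pushforward => /eqP.
    by rewrite mule_eq0 eqe (gt_eqF s0) => /eqP.
  move=> y /= ny; apply: sN => /= h; apply: ny => Uy; apply: h.
  by rewrite faceE //; apply: subsimplex_int_sub; exact: Ug.
apply: (bpoly_free hv); apply: (bpoly_closure hv).
  by rewrite -card_gt0 cardsC1 card_ord.
move=> x xj; have := xj j; rewrite !inE eqxx /= => /eqP /(affine_param_surj hv) [y xy].
by rewrite xy; apply: gU0 => i ij; have := xj i; rewrite !inE ij xy.
Qed.

(** On the face, [q] is the member of the dual basis that belongs to [e], obtained by inverting the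
    Gram matrix of the face. Since [e] is a pair, [q] is orthogonal to all single coordinates, hence
    to the affine functions. *)
Lemma face_dual (R : realType) (d : nat) (v : 'I_d.+1 -> 'rV[R]_d)
    (j : 'I_d.+1) (w : 'rV[R]_d -> R) (e : {set 'I_d.+1}) :
  (0 < d)%N -> nondegenerate_simplex v ->
  prob_density (face_measure v j) (face v j) w ->
  {ae face_measure v j, forall x, face v j x -> 0 < w x} ->
  #|e| = 2%N -> j \notin e ->
  let ipF := weighted_inner (face_measure v j) (face v j) w in
  exists2 q, S2_space (face v j) ipF q & bounded_measurable (face v j) q /\
    forall A : {set 'I_d.+1}, (0 < #|A| <= 2)%N ->
      ipF (bmono v A) q = (A == e)%:R.
Proof.
case: d => // d in v j w e * => _ hv hw w0 e2 je ipF.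
have mF := measurable_face j hv isT; have FS := @face_sub _ _ _ j hv isT.
pose G := bgram (face_measure v j) (face v j) w v [set~ j]%SET.
have Gu : G \in unitmx by apply: posdefmx_unit; exact: face_bgram_posdef.
pose u : 'rV[R]__ := (\row_k (enum_val k == e)%:R) *m invmx G.
pose q := patch (cst 0) (face v j) (bpoly v u).
have qE : {in face v j, q =1 bpoly v u} by move=> x xF; rewrite /q patchE xF.
have dual (A : {set 'I_d.+2}) : (0 < #|A| <= 2)%N -> ipF (bmono v A) q = (A == e)%:R.
  move=> A2; rewrite /ipF weighted_innerC (eq_weighted_inner _ _ qE (fun=> fun=> erefl)).
  (* A monomial that contains [lambda_j] vanishes on the face and differs from [e], so duality
     extends to the monomials of the whole simplex. *)
  have [jA|jA] := boolP (j \in A).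
    rewrite (_ : A == e = false); last by apply: contraNF je => /eqP <-.
    rewrite /weighted_inner /Rintegral integral0_eq // => x.
    rewrite faceE // => /(_ j); rewrite !inE eqxx /= => /eqP xj.
    by rewrite /bmono (bigD1 j) //= xj mul0r mulr0 mul0r.
  have AI : A \in bidx [set~ j]%SET.
    by rewrite inE A2 andbT; apply/fintype.subsetP => a aA;
      rewrite !inE; apply: contraNneq jA => <-.
  rewrite -(enum_rankK_in AI AI) weighted_inner_bpoly_bmono //.
  by rewrite mulmxKV // mxE.
have bq : bounded_measurable (face v j) q.
  have [mb [M hM]] := bounded_measurable_bpoly hv FS u; split.
    by apply: eq_measurable_fun mb => x xF; rewrite qE.
  by exists M => x xF; rewrite qE ?inE //; exact: hM.
exists q; last by split.
split.
  have [p p2 pE] := poly_fun_bpoly v u.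
  by exists p => //; rewrite /q (funext pE).
move=> phi [p p1 ->].
have [a aE] := bary_linear_poly hv (ex_intro2 _ _ p p1 (fun=> erefl)).
rewrite /ipF weighted_innerC (@eq_weighted_inner _ _ _ _ _ _
    (fun x => \sum_i a i * bmono v [set i]%SET x) q q) //; last first.
  by move=> x xF; rewrite patchE xF aE; apply: eq_bigr => i _; rewrite bmono1.
rewrite weighted_inner_suml //; last first.
  by move=> i; exact: bounded_measurable_bmono.
rewrite big1 // => i _; rewrite [weighted_inner _ _ _ _ _]dual ?cards1 //.
by case: eqP e2 => [<-|_ _]; rewrite ?cards1 // mulr0.
Qed.

(** * Coordinate vectors, dimension count and choice of edges *)

Section indicator_matrix.
Context {R : realType} {I : finType}.
Variable B : {set I}.

(** For [f i] in [B], row [i] is the unit vector at [f i], that is, the coordinates of a single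
    basis monomial. *)
Definition indic_mx p (f : 'I_p -> I) : 'M[R]_(p, #|B|) :=
  \matrix_(i, k) (enum_val k == f i)%:R.

Lemma mul_indic_mx p q (f : 'I_p -> I) (g : 'I_q -> I) :
  (forall i, f i \in B) ->
  indic_mx f *m (indic_mx g)^T = \matrix_(i, j) (f i == g j)%:R.
Proof.
move=> fB; apply/matrixP => i j; rewrite !mxE.
rewrite (bigD1 (enum_rank_in (fB i) (f i))) //= big1 => [|k ki].
  by rewrite !mxE enum_rankK_in // eqxx mul1r addr0.
rewrite !mxE; case: eqP => [e|]; last by rewrite mul0r.
by case/eqP: ki; apply: enum_val_inj; rewrite enum_rankK_in.
Qed.

Lemma indic_mx_free p (f : 'I_p -> I) :
  (forall i, f i \in B) -> injective f -> row_free (indic_mx f).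
Proof.
move=> fB fI; apply/row_freeP; exists (indic_mx f)^T.
by rewrite mul_indic_mx //; apply/matrixP => i j; rewrite !mxE (inj_eq fI).
Qed.

End indicator_matrix.

(** Both sides are the dimension of the quadratics; the right one counts [d + 1] singletons and
    [d (d + 1) / 2] pairs. *)
Lemma card_bidx d : (2 <= d)%N ->
  (((d - 2) * (d + 1)) %/ 2 + d.+1 + d.+1)%N = #|bidx [set: 'I_d.+1]%SET|.
Proof.
move=> d2.
have -> : bidx [set: 'I_d.+1]%SET =
    [set A : {set 'I_d.+1} | #|A| == 1%N]%SET :|:
    [set A : {set 'I_d.+1} | #|A| == 2%N]%SET.
  by apply/finset.setP => A; rewrite !inE finset.subsetT; case: #|A| => [|[|[]]].
rewrite cardsU (_ : _ :&: _ = finset.set0)%SET; last first.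
  by apply/finset.setP => A; rewrite !inE; case: #|A| => [|[|[]]].
rewrite cards0 subn0 !card_draws card_ord bin1 bin2 -divn2 /=.
rewrite addnC; congr addn.
rewrite -(@mulnK d.+1 2) // -divnDr ?dvdn_mull //; congr divn; nia.
Qed.

(** The pairs [{j+1, j+2}] are taken modulo [d + 1]. Equal pairs for distinct [j] and [k] would need
    [j = k + 1] and [k = j + 1], hence [j = j + 2], which fails modulo a number at least 3. *)
Lemma edge_opposite d : (2 <= d)%N -> exists e : 'I_d.+1 -> {set 'I_d.+1},
  [/\ injective e, forall j, #|e j| = 2%N & forall j, j \notin e j].
Proof.
case: d => [|[|d]] // _.
have vS (j : 'I_d.+3) : ordS j = (if j.+1 == d.+3 then 0 else j.+1)%N :> nat.
  case: eqP => [/= ->|/= /eqP jd]; first by rewrite modnn.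
  by rewrite modn_small // ltn_neqAle jd ltn_ord.
have S1 (j : 'I_d.+3) : j != ordS j.
  by apply/eqP => /(congr1 val); rewrite [val (ordS j)]vS /=; case: eqP => /=; lia.
have S2 (j : 'I_d.+3) : j != ordS (ordS j).
  apply/eqP => /(congr1 val); rewrite [val (ordS _)]vS vS /=.
  by have := ltn_ord j; do 2!case: eqP => /=; lia.
exists (fun j => [set ordS j; ordS (ordS j)]%SET); split.
- move=> j k jk.
  have : ordS j \in [set ordS k; ordS (ordS k)]%SET by rewrite -jk !inE eqxx.
  rewrite !inE => /orP [/eqP /ordS_inj //|/eqP /ordS_inj jSk].
  have : ordS (ordS j) \in [set ordS k; ordS (ordS k)]%SET by rewrite -jk !inE eqxx orbT.
  rewrite !inE => /orP [/eqP /ordS_inj kSj|/eqP /ordS_inj/ordS_inj //].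
  by have := S2 j; rewrite kSj -jSk eqxx.
- by move=> j; rewrite cards2 S1.
- by move=> j; rewrite !inE negb_or S1 S2.
Qed.

(** * Polynomial spaces on the simplex in coordinates *)

Section simplex_polynomials.
Context {R : realType} {d : nat}.
Variable v : 'I_d.+1 -> 'rV[R]_d.
Hypothesis hv : nondegenerate_simplex v.
Local Notation B := (bidx [set: 'I_d.+1]%SET).

(** The coordinate isomorphism onto [poly_space 2 (simplex v)], with the extension by 0 used
    there. *)
Definition spoly (u : 'rV[R]_#|B|) : 'rV[R]_d -> R :=
  patch (cst 0) (simplex v) (bpoly v u).

Lemma spolyE u x : simplex v x -> spoly u x = bpoly v u x.
Proof. by move=> Sx; rewrite /spoly patchE mem_set. Qed.

Lemma spoly_comb n (c : 'I_n -> R) (M : 'M[R]_(n, #|B|)) :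
  \sum_i c i *: spoly (row i M) = spoly ((\row_i c i) *m M).
Proof.
apply/funext => x; rewrite fct_sumE [RHS]patchE; case: ifPn => xS; last first.
  rewrite big1 // => i _; rewrite -[LHS]/(c i * spoly (row i M) x).
  by rewrite [spoly _ _]patchE (negbTE xS) mulr0.
rewrite /bpoly; under [RHS]eq_bigr do rewrite mxE mulr_suml.
rewrite exchange_big; apply: eq_bigr => i _ /=.
rewrite -[LHS]/(c i * spoly (row i M) x) [spoly _ _]patchE xS mulr_sumr.
by apply: eq_bigr => k _; rewrite !mxE mulrA.
Qed.

Lemma spolyD u u' : spoly (u + u') = spoly u + spoly u'.
Proof.
apply/funext => x; rewrite -[RHS]/(spoly u x + spoly u' x) /spoly !patchE.
case: ifP => _; last by rewrite [RHS]addr0.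
by rewrite /bpoly -big_split; apply: eq_bigr => i _; rewrite mxE mulrDl.
Qed.

Lemma spoly0 : spoly 0 = 0.
Proof.
apply/funext => x; rewrite /spoly patchE; case: ifP => // _.
by rewrite /bpoly big1 // => i _; rewrite mxE mul0r.
Qed.

Lemma spoly_eq0 u : spoly u = 0 -> u = 0.
Proof.
move=> u0; apply: (bpoly_free hv) => x Sx.
by rewrite -spolyE ?u0 //; exact: subsimplex_sub Sx.
Qed.

Lemma poly_space2E : poly_space 2 (simplex v) = range spoly.
Proof.
apply/seteqP; split => f.
  move=> [p p2 ->].
  have [u uE] := bary_quadratic_poly hv (ex_intro2 _ _ p p2 (fun=> erefl)).
  by exists u => //; rewrite /spoly; congr patch; apply/funext => x; rewrite uE.
move=> [u _ <-]; have [p p2 pE] := poly_fun_bpoly v u.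
by exists p => //; rewrite /spoly (funext pE).
Qed.

Lemma bpoly_indic n (f : 'I_n -> {set 'I_d.+1}) (a : 'rV_n) x :
  (forall i, f i \in B) ->
  bpoly v (a *m indic_mx B f) x = \sum_i a 0 i * bmono v (f i) x.
Proof.
move=> fB; rewrite /bpoly; under eq_bigr do rewrite mxE mulr_suml.
rewrite exchange_big; apply: eq_bigr => i _ /=.
rewrite (bigD1 (enum_rank_in (fB i) (f i))) //= big1 => [|k ki].
  by rewrite mxE enum_rankK_in // eqxx mulr1 addr0.
rewrite mxE; case: eqP => [e|]; last by rewrite mulr0 mul0r.
by case/eqP: ki; apply: enum_val_inj; rewrite enum_rankK_in.
Qed.

Lemma bidx1 i : [set i]%SET \in B.
Proof. by rewrite inE finset.subsetT cards1. Qed.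

Lemma bpoly_linear (a : 'rV_d.+1) x :
  bpoly v (a *m indic_mx B (fun i => [set i]%SET)) x =
  \sum_i a 0 i * bary v i x.
Proof.
rewrite bpoly_indic; last exact: bidx1.
by apply: eq_bigr => i _; rewrite bmono1.
Qed.

Lemma poly_space1E : poly_space 1 (simplex v) =
  range (fun a : 'rV_d.+1 => spoly (a *m indic_mx B (fun i => [set i]%SET))).
Proof.
apply/seteqP; split => f.
  move=> [p p1 ->].
  have [a aE] := bary_linear_poly hv (ex_intro2 _ _ p p1 (fun=> erefl)).
  exists (\row_i a i) => //; rewrite /spoly; congr patch.
  apply/funext => x; rewrite bpoly_linear aE.
  by apply: eq_bigr => i _; rewrite mxE.
move=> [a _ <-].
have [|p p1 pE] := @poly_fun_sum R d 1 _ (fun i x => a 0 i * bary v i x).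
  by move=> i; apply: poly_funZ; exact: poly_fun_bary.
exists p => //; rewrite /spoly; congr patch.
by apply/funext => x; rewrite bpoly_linear pE.
Qed.

End simplex_polynomials.

(** * Choice of functionals, orthogonal splitting and unisolvence *)

Theorem theorem3 (R : realType) (d : nat) (hd : (2 <= d)%N)
  (v : 'I_d.+1 -> 'rV[R]_d) (hv : nondegenerate_simplex v)
  (Omega : 'rV[R]_d -> R)
  (hOmega : prob_density (lebesgue_rV d) (simplex v) Omega)
  (hOmega_pos : {ae lebesgue_rV d, forall x, interior (simplex v) x -> 0 < Omega x})
  (omega : 'I_d.+1 -> 'rV[R]_d -> R)
  (homega : forall j, prob_density (face_measure v j) (face v j) (omega j))
  (homega_pos : forall j,
     {ae face_measure v j, forall x, face v j x -> 0 < omega j x})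
  (htrace : forall j, conditional_trace v Omega j (omega j)) :
  let ipS := weighted_inner (lebesgue_rV d) (simplex v) Omega in
  let ipF j := weighted_inner (face_measure v j) (face v j) (omega j) in
  let dt := (((d - 2) * (d + 1)) %/ 2)%N in
  let A : 'M[R]_d.+1 := \matrix_(j, i)
    (\int[face_measure v j]_(x in face v j) (bary v i x * omega j x)) in
  A \in unitmx ->
  exists (q : 'I_d.+1 -> 'rV[R]_d -> R)
         (V : set ('rV[R]_d -> R)) (rho : 'I_dt -> 'rV[R]_d -> R)
         (W : set ('rV[R]_d -> R)) (psi : 'I_d.+1 -> 'rV[R]_d -> R),
    [/\ forall j, S2_space (face v j) (ipF j) (q j),
        is_basis V rho /\ (forall k l, ipS (rho k) (rho l) = (k == l)%:R),
        is_basis W psi,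
        direct_sum (S2_space (simplex v) ipS) V W &
        unisolvent (poly_space 2 (simplex v))
          (range (fun j f => ipF j f (cst 1)) `|`
           range (fun j f => ipF j f (q j)) `|`
           range (fun k f => ipS f (rho k))) /\
        [/\ forall f g, V f -> W g -> ipS f g = 0,
            \matrix_(k, l) ipS (rho l) (rho k) = 1%:M :> 'M[R]_dt &
            \matrix_(k, i) ipS (psi i) (rho k) = 0 :> 'M[R]_(dt, d.+1)]].
Proof.
move=> ipS ipF dt A Au.
have d0 : (0 < d)%N by exact: ltnW.
have mS : measurable (simplex v).
  by rewrite -subsimplexT //; exact: measurable_subsimplex.
have mF j := conj (measurable_face j hv d0) (@face_sub _ _ _ j hv d0).
have [e [eI e2 je]] := edge_opposite hd.
have exq j : exists q, [/\ S2_space (face v j) (ipF j) q,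
    bounded_measurable (face v j) q & forall B : {set 'I_d.+1},
    (0 < #|B| <= 2)%N -> ipF j (bmono v B) q = (B == e j)%:R].
  have [q qS [bq dq]] :=
    face_dual d0 hv (homega j) (homega_pos j) (e2 j) (je j).
  by exists q.
have [q qP] := choice exq.
have Gp := simplex_bgram_posdef hv hOmega hOmega_pos.
set G := bgram _ _ _ _ _ in Gp.
(* From here on polynomials are row vectors over [B]: [Lam] holds the coordinates of the [lambda_i],
   and [L] those of the edge monomials, so that [u *m L^T] reads off the coefficients of [u] at the
   edges. *)
pose B := bidx [set: 'I_d.+1]%SET.
pose Lam : 'M[R]_(d.+1, #|B|) := indic_mx B (fun i => [set i]%SET).
pose L : 'M[R]_(d.+1, #|B|) := indic_mx B e.
have eB j : e j \in B by rewrite inE finset.subsetT e2.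
have Lamf : row_free Lam by apply: indic_mx_free; [exact: bidx1|exact: set1_inj].
have Lf : row_free L by exact: indic_mx_free.
have LLam : L *m Lam^T = 0.
  rewrite mul_indic_mx //; apply/matrixP => j i; rewrite !mxE.
  by case: eqP (e2 j) => // ->; rewrite cards1.
have [Rho [Psi [PsiG RhoRho RhoLam RhoL dec]]] :=
  orthonormal_complement Gp Lamf Lf LLam (card_bidx hd).
have LamL : Lam *m L^T = 0 by rewrite -[Lam]trmxK -trmx_mul LLam trmx0.
have GPsi : G *m Psi^T = L^T by rewrite -PsiG trmx_mul Gp.1.
have LamRho : Lam *m G *m Rho^T = 0.
  by rewrite -[RHS]trmx0 -RhoLam !trmx_mul trmxK Gp.1 mulmxA.
have LRho : L *m Rho^T = 0 by rewrite -[RHS]trmx0 -RhoL trmx_mul trmxK.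
have Psif : row_free Psi.
  apply: inj_row_free => u uP; apply/eqP.
  by rewrite -(mulmx_free_eq0 _ Lf) -PsiG mulmxA uP mul0mx.
have PsiGPsi := posdefmx_unit (posdefmx_congr Psif Gp).
have LamGLam := posdefmx_unit (posdefmx_congr Lamf Gp).
have unit0 m (M : 'M[R]_m) (u : 'rV_m) : M \in unitmx -> u *m M = 0 -> u = 0.
  by move=> Mu /(congr1 (mulmx^~ (invmx M))); rewrite mulmxK // mul0mx.
have ipE u u' : ipS (spoly v u) (spoly v u') = (u *m G *m u'^T) 0 0.
  rewrite -(weighted_inner_bpoly mS hOmega hv (@subset_refl _ _)).
  by apply: eq_weighted_inner => x /set_mem; exact: spolyE.
have LE j u : ipF j (spoly v u) (q j) = (u *m L^T) 0 j.
  have [mFj FS] := mF j; have [_ bq dq] := qP j.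
  rewrite /ipF (@eq_weighted_inner _ _ _ _ _ _ (bpoly v u) (q j) (q j)) //; last first.
    by move=> x /set_mem /FS; exact: spolyE.
  rewrite weighted_inner_suml //; last by move=> i; exact: bounded_measurable_bmono.
  rewrite mxE; apply: eq_bigr => i _; rewrite !mxE; congr (_ * _).
  by apply: dq; have [_ -> ->] := bidxP i.
(* The face means are only computed on affine functions, where [A] appears. *)
have IE j a : ipF j (spoly v (a *m Lam)) (cst 1) = (a *m A^T) 0 j.
  have [mFj FS] := mF j.
  rewrite /ipF (@eq_weighted_inner _ _ _ _ _ _
    (fun x => \sum_i a 0 i * bary v i x) (cst 1) (cst 1)) //; last first.
    by move=> x /set_mem /FS Sx; rewrite spolyE // bpoly_linear.
  rewrite weighted_inner_suml //; last 2 first.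
  - move=> i; rewrite -(funext (bmono1 v i)).
    exact: bounded_measurable_bmono.
  - by split => //; exists 1 => x _; rewrite normr1.
  rewrite mxE; apply: eq_bigr => i _; rewrite !mxE; congr (_ * _).
  by apply: eq_Rintegral => x _; rewrite mulr1.
(* Written in the form of [is_basis], whose spanning half then holds by reflexivity. *)
pose span n (M : 'M[R]_(n, #|B|)) : set ('rV[R]_d -> R) :=
  [set f | exists c : 'I_n -> R, f = \sum_i c i *: spoly v (row i M)].
have spanP n (M : 'M[R]_(n, #|B|)) f :
    span n M f <-> exists c : 'rV_n, f = spoly v (c *m M).
  split=> [[c ->]|[c ->]]; first by exists (\row_i c i); rewrite spoly_comb.
  exists (c 0); rewrite spoly_comb; congr (spoly _ (_ *m _)).
  by apply/rowP => i; rewrite mxE.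
have basis n (M : 'M[R]_(n, #|B|)) : row_free M ->
    is_basis (span n M) (fun i => spoly v (row i M)).
  move=> Mf; split => // c; rewrite spoly_comb => /(spoly_eq0 hv) /eqP.
  rewrite mulmx_free_eq0 // => /eqP /rowP c0 i.
  by have := c0 i; rewrite !mxE.
have Rhof : row_free Rho.
  apply: inj_row_free => u uP.
  by rewrite -[u]mulmx1 -RhoRho !mulmxA uP !mul0mx.
exists q, (span _ Rho), (fun k => spoly v (row k Rho)),
  (span _ Psi), (fun i => spoly v (row i Psi)).
have rhoE k l : ipS (spoly v (row k Rho)) (spoly v (row l Rho)) = (k == l)%:R.
  rewrite ipE -row_mul; have /matrixP/(_ k l) := RhoRho.
  rewrite [RHS]mxE => <-; rewrite !mxE; apply: eq_bigr => i _.
  by rewrite ![row _ _ _ _]mxE ![(_^T) _ _]mxE [row _ _ _ _]mxE.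
have orth f g : span _ Rho f -> span _ Psi g -> ipS f g = 0.
  move=> /spanP [b ->] /spanP [c ->].
  by rewrite ipE trmx_mul -!mulmxA (mulmxA G) GPsi (mulmxA Rho) RhoL mul0mx mulmx0 mxE.
split.
- by move=> j; have [] := qP j.
- by split => //; exact: basis.
- exact: basis.
- split; last first.
    apply/seteqP; split => f /=.
      (* A common element is orthogonal to itself, so definiteness makes its coordinates vanish. *)
      move=> [/spanP [b fb] fPsi].
      have := orth _ _ ((spanP _ _ _).2 (ex_intro _ b fb)) fPsi.
      rewrite fb ipE => h.
      have [->|/Gp.2] := eqVneq (b *m Rho) 0; first exact: spoly0.
      by rewrite h ltxx.
    by move=> ->; split; apply/spanP; exists 0; rewrite mul0mx spoly0.
  apply/seteqP; split => f.
    move=> []; rewrite poly_space2E // => -[u _ <-] hu.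
    have [a [b [c uE]]] := dec u.
    (* Testing against each [lambda_i] leaves only the affine part, as [Rho] and [Psi] are
       orthogonal to [Lam]; the Gram matrix of [Lam] is invertible, so [a = 0]. *)
    have uLam : u *m G *m Lam^T = 0.
      apply/rowP => i; rewrite [RHS]mxE.
      have := hu (spoly v (delta_mx 0 i *m Lam)).
      rewrite ipE trmx_mul mulmxA trmx_delta -colE mxE; apply.
      by rewrite poly_space1E //; exists (delta_mx 0 i).
    have a0 : a = 0.
      apply: (unit0 _ _ _ LamGLam); move: uLam; rewrite uE !mulmxDl.
      rewrite -!mulmxA (mulmxA Psi) PsiG LLam (mulmxA Rho) RhoLam !mulmx0 !addr0.
      by [].
    exists (spoly v (b *m Rho)); first by apply/spanP; exists b.
    exists (spoly v (c *m Psi)); first by apply/spanP; exists c.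
    by rewrite uE a0 mul0mx add0r spolyD.
  move=> [_ /spanP [b ->] [_ /spanP [c ->] <-]]; rewrite -spolyD; split.
    by rewrite poly_space2E //; exists (b *m Rho + c *m Psi).
  move=> phi; rewrite poly_space1E // => -[a _ <-].
  rewrite ipE trmx_mul !mulmxDl -!mulmxA (mulmxA Psi) PsiG.
  rewrite (mulmxA L) LLam (mulmxA G) (mulmxA Rho) (mulmxA Rho) RhoLam.
  by rewrite !mul0mx !mulmx0 addr0 mxE.
split; last first.
  split => //; apply/matrixP => k l; rewrite !mxE.
    by rewrite rhoE eq_sym.
  rewrite /ipS weighted_innerC; apply: orth; apply/spanP.
    by exists (delta_mx 0 k); rewrite rowE.
  by exists (delta_mx 0 l); rewrite rowE.
move=> p; rewrite poly_space2E // => -[u _ <-] h.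
have [a [b [c uE]]] := dec u.
(* The interior functionals see only the [Rho] part, which is orthonormal and orthogonal to the
   rest. *)
have uRho : u *m G *m Rho^T = 0.
  apply/rowP => k; rewrite [RHS]mxE.
  have := h (fun f => ipS f (spoly v (row k Rho))) (or_intror (ex_intro2 _ _ k I erefl)).
  by rewrite /= ipE tr_row colE mulmxA -colE mxE.
have b0 : b = 0.
  move: uRho; rewrite uE !mulmxDl -!mulmxA (mulmxA Lam) LamRho.
  by rewrite (mulmxA Psi) PsiG LRho (mulmxA Rho) RhoRho !mulmx0 mulmx1 add0r addr0.
(* The edge coefficients of an affine function are 0, so once [b = 0] these equations read [c] times
   the Gram matrix of [Psi]. *)
have uL : u *m L^T = 0.
  apply/rowP => j; rewrite [RHS]mxE -LE.
  exact: (h _ (or_introl (or_intror (ex_intro2 _ _ j I erefl)))).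
have c0 : c = 0.
  apply: (unit0 _ _ _ PsiGPsi); move: uL; rewrite uE b0 mul0mx addr0 mulmxDl.
  by rewrite -!mulmxA LamL mulmx0 add0r -GPsi !mulmxA.
have uLam : u = a *m Lam by rewrite uE b0 c0 !mul0mx !addr0.
(* Only the affine part is left, and the face means determine it because [A] is invertible. *)
have a0 : a = 0.
  apply: (unit0 _ A^T); first by rewrite unitmx_tr.
  apply/rowP => j; rewrite [RHS]mxE -IE -uLam.
  exact: (h _ (or_introl (or_introl (ex_intro2 _ _ j I erefl)))).
by rewrite uLam a0 mul0mx spoly0.
Qed.
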